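(* Let $n\in\mathbb N$, $n\geq 2$, be fixed, $\lambda=\frac{n-1}{2}$, and suppose that $$a=-L^2(L+2\lambda)^2$$ for some $L\in(0,\infty)$ such that $\sqrt{\lambda^2-2L\lambda-L^2}\in\mathbb R$, i.e., $$0<L\leq(\sqrt2-1)\cdot\lambda.$$ Denote by $G_a$ the function $$G_a:=\sum_{l=0,\,l\neq L}^\infty\frac{1}{l^2(n+l-1)^2+a}\,\frac{\lambda+l}{\lambda}\,\mathcal C_l^\lambda\qquad\text{if }L\in\mathbb N,$$ respectively $$G_a:=\sum_{l=0}^\infty\frac{1}{l^2(n+l-1)^2+a}\,\frac{\lambda+l}{\lambda}\,\mathcal C_l^\lambda\qquad\text{if }L\notin\mathbb N.$$ Then $$\begin{aligned} G_a(\cos\vartheta)=&\int_0^1\left(A\, r^{-L-1}-A\, r^{L+2\lambda-1}+B\, r^{\lambda+\sqrt{\lambda^2-2L\lambda-L^2}-1}-B\, r^{\lambda-\sqrt{\lambda^2-2L\lambda-L^2}-1}\right)\\ &\qquad\cdot\left[\Sigma_n\, p_r^\lambda(\cos\vartheta)-\sum_{l=0}^{\lfloor L\rfloor} r^l\,\frac{\lambda+l}{\lambda}\,\mathcal C_l^\lambda(\cos\vartheta)\right]dr\\ &+\sum_{l=0}^{\lceil L\rceil-1}\frac{1}{l^2(n+l-1)^2+a}\,\frac{\lambda+l}{\lambda}\,\mathcal C_l^\lambda(\cos\vartheta) \end{aligned}$$ with $$A=\frac{1}{4L(L+\lambda)(L+2\lambda)},\qquad B=\frac{1}{4L(L+2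\lambda)\sqrt{\lambda^2-2L\lambda-L^2}}.$$
   Context: $\mathcal C_l^\lambda$ denotes the Gegenbauer polynomial of degree $l$ and order $\lambda$ (standard normalization, generating function $\sum_{l\ge0}\mathcal C_l^\lambda(t)r^l=(1-2tr+r^2)^{-\lambda}$). $\Sigma_n=\frac{2\pi^{(n+1)/2}}{\Gamma((n+1)/2)}$ is the surface measure of the unit sphere $\mathcal S^n\subseteq\mathbb R^{n+1}$. The Poisson kernel on $\mathcal S^n$ is, for $r\in[0,1)$, $$p_r^\lambda(\cos\vartheta)=\frac{1}{\Sigma_n}\sum_{l=0}^\infty r^l\,\frac{\lambda+l}{\lambda}\,\mathcal C_l^\lambda(\cos\vartheta)=\frac{1}{\Sigma_n}\,\frac{1-r^2}{(1-2r\cos\vartheta+r^2)^{(n+1)/2}}.$$ Zonal functions on $\mathcal S^n$ are those depending only on the first hyperspherical coordinate $\vartheta$ (where $x_1=\cos\vartheta$); they are identified with functions of $t=\cos\vartheta$. Here $\mathbb N=\{1,2,\dots\}$.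
   Formalization: At L=(√2−1)λ, where B=1/0, the B-difference is read as its limit r^(λ−1) ln r/(2L(L+2λ)); as the series for G_a diverges pointwise for large n, G_a(cos ϑ) is read as its Abel sum (and as its ordinary sum whenever that exists), with +∞ allowed at ϑ=0. *)

(* Defs.v *)
From mathcomp Require Export all_boot all_order all_algebra.
From mathcomp Require Import ring.
From mathcomp Require Export all_classical all_reals all_analysis.
Export Order.TTheory GRing.Theory Num.Theory numFieldNormedType.Exports.

Set Implicit Arguments.
Unset Strict Implicit.
Unset Printing Implicit Defensive.

Local Open Scope classical_set_scope.
Local Open Scope ring_scope.

Section defs.
Context {R : realType}.
Implicit Types (n l : nat) (lam L a r t s : R).

(* The coefficient of r ^+ l in the generating function (1 - 2tr + r^2)^(-lam),
   as a Taylor coefficient at r = 0. *)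
Definition gegenbauer lam l t : R :=
  derive1n l (fun r => (1 - 2 * t * r + r ^+ 2) `^ (- lam)) 0 / l`!%:R.

Definition Gamma (x : R) : R :=
  \int[lebesgue_measure]_(u in `]0, +oo[) (u `^ (x - 1) * expR (- u)).

Definition sphere_area n : R :=
  2 * pi `^ (n.+1%:R / 2) / Gamma (n.+1%:R / 2).

Definition gorder n : R := (n%:R - 1) / 2.

(* ((lam + l) / lam) C_l^lam *)
Definition zonal_harmonic lam l t : R :=
  (lam + l%:R) / lam * gegenbauer lam l t.

Definition poisson_kernel n r t : R :=
  (sphere_area n)^-1 *
  limn (series (fun l => r ^+ l * zonal_harmonic (gorder n) l t)).

Definition green_coef n a l : R :=
  (l%:R ^+ 2 * (n%:R + l%:R - 1) ^+ 2 + a)^-1.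

(* The l-th term of the series G_a; the index l = L is left out, a condition
   that only matters if L is an integer. *)
Definition green_term n a L t l : R :=
  if l%:R == L then 0 else green_coef n a l * zonal_harmonic (gorder n) l t.

Definition discr_root lam L : R := Num.sqrt (lam ^+ 2 - 2 * L * lam - L ^+ 2).

Definition coefA lam L : R := (4 * L * (L + lam) * (L + 2 * lam))^-1.

Definition coefB lam L : R := (4 * L * (L + 2 * lam) * discr_root lam L)^-1.

(* The difference of the two B-terms.  If the square root vanishes, i.e. if
   L = (sqrt 2 - 1) lam, then B is infinite and the difference is of the form
   oo * 0; it is then read as its limit when the root tends to 0
   (see [termB_limit]). *)
Definition termB lam L r : R :=
  let s := discr_root lam L in
  if s == 0 then r `^ (lam - 1) * ln r / (2 * L * (L + 2 * lam))
  else coefB lam L * r `^ (lam + s - 1) - coefB lam L * r `^ (lam - s - 1).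

Definition green_weight lam L r : R :=
  coefA lam L * r `^ (- L - 1) - coefA lam L * r `^ (L + 2 * lam - 1)
  + termB lam L r.

Definition green_integrand n L t r : R :=
  green_weight (gorder n) L r *
  (sphere_area n * poisson_kernel n r t
   - \sum_(0 <= l < (Num.truncn L).+1) r ^+ l * zonal_harmonic (gorder n) l t).

(* The integral is the Lebesgue integral, with value +oo allowed: at the pole
   t = 1 both sides of the formula are +oo as soon as n >= 4. *)
Definition green_closed_form n a L t : \bar R :=
  (\int[lebesgue_measure]_(r in `]0%R, 1%R[) (green_integrand n L t r)%:E
   + (\sum_(0 <= l < `|Num.ceil L|%N)
        green_coef n a l * zonal_harmonic (gorder n) l t)%R%:E)%E.

Definition has_sum (u : nat -> R) (S : \bar R) : Prop :=
  (fun N => (series u N)%:E) @ \oo --> S.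

(* Zonal series of functions singular at the pole diverge at every point in
   high dimension: the terms of G_a are of order l^(lam - 4) times an
   oscillating factor for 0 < theta < pi.  The function defined by the series
   is then recovered from its Poisson (Abel) means; by Abel's theorem these
   have the same limit as the partial sums whenever the latter converge. *)
Definition has_abel_sum (u : nat -> R) (S : \bar R) : Prop :=
  (forall x, 0 <= x < 1 -> cvgn (series (fun l => u l * x ^+ l))) /\
  (limn (series (fun l => u l * x ^+ l)))%:E @[x --> (1 : R)^'-] --> S.

Lemma termB_limit lam L r : 0 < r ->
  (4 * L * (L + 2 * lam) * s)^-1 * r `^ (lam + s - 1)
  - (4 * L * (L + 2 * lam) * s)^-1 * r `^ (lam - s - 1) @[s --> (0 : R)^'] -->
  r `^ (lam - 1) * ln r / (2 * L * (L + 2 * lam)).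
Proof.
move=> r0; have rN0 : r != 0 by rewrite gt_eqF.
pose h s := r `^ (lam + s - 1) - r `^ (lam - s - 1).
have hE : h = fun s => expR ((lam + s - 1) * ln r) - expR ((lam - s - 1) * ln r).
  by apply/funext => s; rewrite /h /powR (negbTE rN0).
have dh : is_derive (0 : R) (1 : R) h (2 * (r `^ (lam - 1) * ln r)).
  rewrite hE; apply: is_derive_eq.
  rewrite /powR (negbTE rN0) /= !(addr0, subr0, add0r) /GRing.scale /=; ring.
have [/cvg_ex[/= l hl] dhE] := dh.
have /= {}hl : s^-1 * h s @[s --> (0 : R)^'] --> 2 * (r `^ (lam - 1) * ln r).
  rewrite -dhE /derive (cvg_lim _ hl)//.
  have h0 : h 0 = 0 by rewrite /h addr0 subr0 subrr.
  apply: cvg_trans hl; apply: near_eq_cvg; near=> s.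
  by rewrite /= h0 subr0 addr0 /GRing.scale /= mulr1.
have -> : r `^ (lam - 1) * ln r / (2 * L * (L + 2 * lam)) =
    (4 * L * (L + 2 * lam))^-1 * (2 * (r `^ (lam - 1) * ln r)).
  have -> : 4 * L * (L + 2 * lam) = 2 * (2 * L * (L + 2 * lam)) by ring.
  by rewrite [in RHS]invfM [RHS]mulrACA mulVf ?pnatr_eq0 // mul1r mulrC.
have cl := @cvgMl_tmp _ _ _ _ _ (4 * L * (L + 2 * lam))^-1 _ hl.
apply: cvg_trans; last exact: cl.
apply: near_eq_cvg; near=> s.
by rewrite /= -mulrBr (invfM _ s) mulrA.
Unshelve. all: by end_near. Qed.

End defs.

(* Main.v *)
Require Import Defs.
From mathcomp Require Import measurable_realfun.
From mathcomp Require Import ring lra zify.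

(** Write lam = (n - 1) / 2, m = L + lam and s for the square root in the
    statement, so that m^2 - s^2 = 2 L (L + 2 lam).  The denominator of the
    coefficient of index l factors as
      l^2 (l + 2 lam)^2 - L^2 (L + 2 lam)^2
        = ((l + lam)^2 - m^2) ((l + lam)^2 - s^2),
    and by partial fractions the coefficient is the l-th moment on ]0, 1[ of
    the weight, because r^(b - 1) sinh(s ln r) / s has integral
    - 1 / (b^2 - s^2) for b > s ([weight_moment]).  This holds exactly for
    l > L, which is why the terms of index up to the integer part of L are
    taken out of the Poisson kernel and added separately.  The factor
    sinh(s ln r) / s extends to s = 0 with the value ln r, so the degenerate
    case where the two exponents of the B-terms merge needs no separate
    argument.

    Summing the moments against the zonal harmonics exchanges a series and an
    integral.  The Abel mean at x < 1 of the series of index l > L is the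
    integral of the weight against the tail of the Poisson series at r x, by
    dominated convergence ([abel_mean_moments]); what remains is the limit
    x -> 1.
    - For 0 < theta <= pi the quadratic 1 - 2 r cos(theta) + r^2 stays away
      from 0, hence the closed form of the Poisson kernel is bounded, and
      dominated convergence applies again ([abel_mean_moments_bounded]).
    - For theta = 0 the zonal harmonics are nonnegative and so is the weight,
      because sinh(s x) / s increases with s ([sinh_ln_le]).  Monotone
      convergence then sums the series itself, possibly to +oo
      ([has_sum_moments]), and the theorem of Abel, valid for infinite sums
      too ([abel_theorem]), gives the Abel sum.
    The theorem of Abel also shows that a series with a sum has the same Abel
    sum, which is the last claim.

    The facts on Gegenbauer polynomials all come from their three-term
    recurrence.  It is equivalent to the differential equation
    (1 - 2 t r + r^2) G' = 2 lam (t - r) G for the generating function G,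
    which identifies the Taylor coefficients in the definition
    ([gegenbauerE]), and also to the recurrence
      (l + 1) C_{l+1} = 2 lam sum_(k <= l) cos((l + 1 - k) theta) C_k
    ([gegen_cos_sum]), from which one reads off polynomial growth in l, so
    that the generating series converges in the whole unit disc, and
    nonnegativity at theta = 0. *)

Set Implicit Arguments.
Unset Strict Implicit.
Unset Printing Implicit Defensive.

Local Open Scope classical_set_scope.
Local Open Scope ring_scope.

(** * Power series with coefficients of polynomial growth *)
Section power_series.
Context {R : realType}.
Implicit Types (c d : R^nat) (x y r : R).

(** Polynomial growth is a convenient sufficient condition for convergence in
    the open unit disc: unlike the condition on the radius itself, it is
    immediately stable under products of coefficients, shifts and formal
    differentiation. *)
Definition poly_growth c :=
  exists M (K : nat), forall l, `|c l| <= M * l.+1%:R ^+ K.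

Lemma poly_growth_ge0 c (M : R) (K : nat) :
  (forall l, `|c l| <= M * l.+1%:R ^+ K) -> 0 <= M.
Proof. by move=> /(_ 0); rewrite expr1n mulr1; apply: le_trans. Qed.

(** The right-hand side is the sum of the geometric series, whose first l + 1
    terms are all at least x^l. *)
Lemma natS_expr_le x l : 0 <= x -> x < 1 -> l.+1%:R * x ^+ l <= (1 - x)^-1.
Proof.
move=> x0 x1; rewrite -(ler_pM2r (_ : 0 < 1 - x)) ?subr_gt0//.
rewrite mulVf; last by rewrite gt_eqF// subr_gt0.
suff : l.+1%:R * x ^+ l * (1 - x) <= 1 - x ^+ l.+1.
  by move=> /le_trans; apply; rewrite lerBlDr lerDl exprn_ge0.
elim: l => [|l ih]; first by rewrite expr0 expr1 !mul1r.
have -> : l.+2%:R * x ^+ l.+1 * (1 - x) =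
    x * (l.+1%:R * x ^+ l * (1 - x)) + x ^+ l.+1 * (1 - x).
  by rewrite -(natr1 l.+1) exprS; ring.
apply: le_trans (lerD (ler_wpM2l x0 ih) (lexx _)) _.
rewrite -subr_ge0 [leRHS](_ : _ = (1 - x) * (1 - x ^+ l.+1)).
  by rewrite mulr_ge0// subr_ge0 ?exprn_ile1// ltW.
by rewrite exprS; ring.
Qed.

Lemma is_cvg_series_natS_expr (K : nat) x : 0 <= x -> x < 1 ->
  cvgn (series (fun l => l.+1%:R ^+ K * x ^+ l)).
Proof.
elim: K x => [|K ih] x x0 x1.
  have -> : (fun l => l.+1%:R ^+ 0 * x ^+ l) = geometric 1 x.
    by apply/funext => l; rewrite expr0.
  by apply: is_cvg_geometric_series; rewrite ger0_norm.
(* A geometric factor x / y absorbs one power of l + 1, leaving y < 1. *)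
pose y := (1 + x) / 2.
have y0 : 0 < y by rewrite /y; lra.
have y1 : y < 1 by rewrite /y; lra.
have xy0 : 0 <= x / y by rewrite divr_ge0// ltW.
have xy1 : x / y < 1 by rewrite ltr_pdivrMr// mul1r /y; lra.
pose M := (1 - x / y)^-1.
have M0 : 0 <= M by rewrite invr_ge0 subr_ge0 ltW.
apply: (@series_le_cvg _ _ (M *: (fun l => l.+1%:R ^+ K * y ^+ l))).
- by move=> l; rewrite mulr_ge0// exprn_ge0.
- by move=> l; rewrite !fctE mulr_ge0// mulr_ge0// exprn_ge0// ltW.
- move=> l; rewrite !fctE /GRing.scale /= exprSr -mulrA.
  have -> : x ^+ l = (x / y) ^+ l * y ^+ l.
    by rewrite expr_div_n divfK// expf_neq0// gt_eqF.
  rewrite [leRHS]mulrCA ler_wpM2l ?exprn_ge0//.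
  by rewrite mulrA; apply: ler_wpM2r; [exact/exprn_ge0/ltW|exact: natS_expr_le].
- exact/is_cvg_seriesZ/ih/y1/ltW.
Qed.

Lemma is_cvg_pseries_norm c x : poly_growth c -> `|x| < 1 ->
  cvgn (series (fun l => `|c l| * `|x| ^+ l)).
Proof.
move=> [M [K cM]] x1.
have M0 := poly_growth_ge0 cM.
apply: (@series_le_cvg _ _ (M *: (fun l => l.+1%:R ^+ K * `|x| ^+ l))).
- by move=> l; rewrite mulr_ge0// exprn_ge0.
- by move=> l; rewrite !fctE mulr_ge0// mulr_ge0// exprn_ge0// ltW.
- by move=> l; rewrite !fctE /GRing.scale /= mulrA ler_wpM2r// exprn_ge0.
- exact/is_cvg_seriesZ/is_cvg_series_natS_expr.
Qed.

Lemma is_cvg_pseries c x : poly_growth c -> `|x| < 1 -> cvgn (pseries c x).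
Proof.
move=> cP x1; apply: normed_cvg.
rewrite /normed_series_of /= (_ : (fun _ => _) = (fun l => `|c l| * `|x| ^+ l)).
  exact: is_cvg_pseries_norm.
by apply/funext => l; rewrite normrM normrX.
Qed.

Lemma poly_growth_shift c N : poly_growth c -> poly_growth (fun l => c (l + N)%N).
Proof.
move=> [M [K cM]]; exists (M * N.+1%:R ^+ K), K => l.
have M0 := poly_growth_ge0 cM.
apply: le_trans (cM _) _; rewrite -mulrA ler_wpM2l// -exprMn.
by rewrite lerXn2r ?nnegrE// -natrM ler_nat; lia.
Qed.

Lemma poly_growthM c d : poly_growth c -> poly_growth d ->
  poly_growth (fun l => c l * d l).
Proof.
move=> [M [K cM]] [M' [K' dM]]; exists (M * M'), (K + K')%N => l.
by rewrite normrM exprD mulrACA ler_pM.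
Qed.

Lemma poly_growth_linear a b : poly_growth (fun l : nat => a * l%:R + b : R).
Proof.
exists (`|a| + `|b|), 1 => l; rewrite expr1.
apply: le_trans (ler_normD _ _) _.
rewrite normrM normr_nat mulrDl lerD// ?ler_wpM2l// ?ler_nat//.
by rewrite ler_peMr// ler1n.
Qed.

Lemma poly_growthD c d : poly_growth c -> poly_growth d ->
  poly_growth (fun l => c l + d l).
Proof.
move=> [M [K cM]] [M' [K' dM]]; exists (M + M'), (K + K')%N => l.
have M0 := poly_growth_ge0 cM; have M'0 := poly_growth_ge0 dM.
rewrite (le_trans (ler_normD _ _))// mulrDl lerD//.
  apply: le_trans (cM l) _; rewrite ler_wpM2l// ler_weXn2l ?ler1n//; lia.
apply: le_trans (dM l) _; rewrite ler_wpM2l// ler_weXn2l ?ler1n//; lia.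
Qed.

Lemma poly_growthS c : poly_growth c -> poly_growth (fun l => c l.+1).
Proof.
by move=> /(poly_growth_shift 1); under eq_fun do rewrite addn1.
Qed.

Lemma poly_growthZ a c : poly_growth c -> poly_growth (fun l => a * c l).
Proof.
move=> cP; have := poly_growthM (poly_growth_linear 0 a) cP.
by under eq_fun do rewrite mul0r add0r.
Qed.

Lemma poly_growth_natM c : poly_growth c -> poly_growth (fun l => l%:R * c l).
Proof.
move=> cP; have := poly_growthM (poly_growth_linear 1 0) cP.
by under eq_fun do rewrite mul1r addr0.
Qed.

Lemma poly_growth_diffs c : poly_growth c -> poly_growth (pseries_diffs c).
Proof.
by move=> /poly_growth_natM/poly_growthS.
Qed.

Definition psum c x := limn (pseries c x).

Lemma cvg_psum c x : poly_growth c -> `|x| < 1 ->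
  series (fun l => c l * x ^+ l) @ \oo --> psum c x.
Proof. by move=> cP x1; apply: is_cvg_pseries. Qed.

Lemma psumD c d x : poly_growth c -> poly_growth d -> `|x| < 1 ->
  psum (fun l => c l + d l) x = psum c x + psum d x.
Proof.
move=> cP dP x1; rewrite /psum -lim_seriesD; try exact: is_cvg_pseries.
rewrite /pseries; congr (limn (series _)).
by apply/funext => l; exact: mulrDl.
Qed.

Lemma psumZ a c x : poly_growth c -> `|x| < 1 ->
  psum (fun l => a * c l) x = a * psum c x.
Proof.
move=> cP x1; apply/cvg_lim => //; rewrite /pseries.
rewrite (_ : series _ = (fun n => a * series (fun l => c l * x ^+ l) n)).
  exact: cvgMl_tmp (cvg_psum cP x1).
apply/funext => n /=.
by rewrite /series /= mulr_sumr; apply: eq_bigr => i _; rewrite mulrA.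
Qed.

Lemma psum_recl c x : poly_growth c -> `|x| < 1 ->
  psum c x = c 0 + x * psum (fun l => c l.+1) x.
Proof.
move=> cP x1; apply/cvg_lim => //; rewrite /pseries -cvg_shiftS.
have c1P := poly_growthS cP.
rewrite (_ : (fun _ => _) =
    (fun n => c 0 + x * series (fun l => c l.+1 * x ^+ l) n)).
  by apply: cvgD (cvg_cst _) (cvgMl_tmp (cvg_psum c1P x1)).
apply/funext => n /=.
rewrite /series /= big_nat_recl// expr0 mulr1 mulr_sumr; congr (_ + _).
by apply: eq_bigr => i _; rewrite exprS mulrCA.
Qed.

Lemma psum_natM c x : poly_growth c -> `|x| < 1 ->
  psum (fun l => l%:R * c l) x = x * psum (pseries_diffs c) x.
Proof.
by move=> cP x1; rewrite psum_recl ?mul0r ?add0r//; exact: poly_growth_natM.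
Qed.

Lemma psum_shift c N x : poly_growth c -> `|x| < 1 ->
  psum c x = \sum_(0 <= l < N) c l * x ^+ l + x ^+ N * psum (fun l => c (l + N)%N) x.
Proof.
move=> cP x1; elim: N => [|N ih].
  by rewrite big_nil add0r expr0 mul1r; under [in RHS]eq_fun do rewrite addn0.
rewrite ih big_nat_recr//= -addrA; congr (_ + _).
rewrite psum_recl//; last exact: poly_growth_shift.
rewrite /= add0n mulrDr exprSr mulrA; congr (_ + _ * psum _ _); first exact: mulrC.
by apply/funext => l; rewrite addSnnS.
Qed.

Lemma is_derive_psum c x : poly_growth c -> `|x| < 1 ->
  is_derive x (1 : R) (psum c) (psum (pseries_diffs c) x).
Proof.
move=> cP x1; pose K := (1 + `|x|) / 2.
have K0 : 0 <= K by rewrite /K; have := normr_ge0 x; lra.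
have K1 : `|K| < 1 by rewrite ger0_norm// /K; lra.
apply: (@pseries_snd_diffs _ c K).
- exact: is_cvg_pseries.
- exact/is_cvg_pseries/K1/poly_growth_diffs.
- exact/is_cvg_pseries/K1/poly_growth_diffs/poly_growth_diffs.
- by rewrite (ger0_norm K0) /K; lra.
Qed.

Lemma continuous_psum c x : poly_growth c -> `|x| < 1 ->
  {for x, continuous (psum c)}.
Proof.
move=> cP x1; have [D _] := is_derive_psum cP x1.
exact/differentiable_continuous/derivable1_diffP.
Qed.

Lemma near_norm_lt1 x : `|x| < 1 -> \forall y \near x, `|y| < 1.
Proof.
move=> x1; apply: (@cvgr_lt R _ (nbhs x) _ (fun y => `|y|) `|x|) => //.
exact: norm_continuous.
Qed.

Lemma derive1n_psum c (f : R -> R) l x : poly_growth c ->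
  (forall y, `|y| < 1 -> f y = psum c y) -> `|x| < 1 ->
  derive1n l f x = psum (iter l (@pseries_diffs R) c) x.
Proof.
move=> cP fE; elim: l x => [|l ih] x x1; first exact: fE.
have lP : poly_growth (iter l (@pseries_diffs R) c).
  by elim: l {ih} => //= l; exact: poly_growth_diffs.
rewrite derive1nS derive1E.
rewrite (@near_eq_derive _ _ _ _ (psum (iter l (@pseries_diffs R) c))).
  by have [_ ->] := is_derive_psum lP x1.
near=> y; apply: ih; near: y; exact: near_norm_lt1.
Unshelve. all: by end_near. Qed.

Lemma psum0 c : psum c 0 = c 0.
Proof.
apply/cvg_lim => //; rewrite /pseries -cvg_shiftS.
rewrite (_ : (fun _ => _) = fun=> c 0); first exact: cvg_cst.
apply/funext => n; rewrite /series /= big_nat_recl//= expr0 mulr1.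
by rewrite big1 ?addr0// => i _; rewrite expr0n mulr0.
Qed.

Lemma iter_pseries_diffs c l k :
  iter l (@pseries_diffs R) c k * k`!%:R = (k + l)`!%:R * c (k + l)%N.
Proof.
elim: l k => [|l ih] k; first by rewrite addn0 mulrC.
by rewrite /= /pseries_diffs mulrAC -natrM -factS mulrC ih addSnnS.
Qed.

(** Only the germ of the function at 0 matters for its iterated derivatives,
    so agreement with the power series on the unit disc suffices. *)
Lemma taylor_coef_psum c (f : R -> R) l : poly_growth c ->
  (forall y, `|y| < 1 -> f y = psum c y) ->
  derive1n l f 0 / l`!%:R = c l.
Proof.
move=> cP fE; rewrite (derive1n_psum _ cP fE) ?normr0// psum0.
have := iter_pseries_diffs c l 0; rewrite fact0 mulr1 add0n => ->.
by rewrite mulrAC divff ?mul1r// pnatr_eq0 -lt0n fact_gt0.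
Qed.

(** Dividing by y^N is harmless for y > 1/2, and for y <= 1/2 the shifted
    series is dominated by its absolute value at 1/2. *)
Lemma psum_shift_bounded c N B : poly_growth c ->
  (forall y, 0 <= y < 1 -> `|psum c y| <= B) ->
  exists C, forall y, 0 <= y < 1 -> `|psum (fun l => c (l + N)%N) y| <= C.
Proof.
move=> cP cB; pose d l := c (l + N)%N.
have dP : poly_growth d by exact: poly_growth_shift.
have B0 : 0 <= B.
  by have := cB 0; rewrite lexx ltr01 => /(_ isT); apply: le_trans.
have half1 : `|2^-1 : R| < 1 by rewrite ger0_norm// invf_lt1// ltr1n.
pose C1 := limn (series (fun l => `|d l| * `|2^-1| ^+ l)).
pose C2 := (B + \sum_(0 <= l < N) `|c l|) * 2 ^+ N.
have C20 : 0 <= C2 by rewrite mulr_ge0// ?addr_ge0// ?sumr_ge0// exprn_ge0.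
have C10 : 0 <= C1.
  apply: limr_ge; first exact: is_cvg_pseries_norm.
  by apply: nearW => n; apply: sumr_ge0 => l _; rewrite mulr_ge0// exprn_ge0.
exists (C1 + C2) => y /andP[y0 y1]; have y1' : `|y| < 1 by rewrite ger0_norm.
have [yh|hy] := leP y 2^-1.
  rewrite -[leLHS]addr0 lerD//.
  have ncvg : cvgn (series (fun l => `|d l * y ^+ l|)).
    under eq_fun do rewrite normrM normrX; exact: is_cvg_pseries_norm.
  apply: le_trans (lim_series_norm ncvg) _; apply: lim_series_le => //.
    exact: is_cvg_pseries_norm.
  move=> l; rewrite /= normrM normrX ler_wpM2l// lerXn2r ?nnegrE//.
  by rewrite !ger0_norm// invr_ge0.
have ygt0 : 0 < y by rewrite (lt_trans _ hy)// invr_gt0.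
have yN0 : 0 < y ^+ N by rewrite exprn_gt0.
have -> : psum d y = (psum c y - \sum_(0 <= l < N) c l * y ^+ l) / y ^+ N.
  by rewrite (psum_shift N cP y1') addrC addKr mulrC mulKf// gt_eqF.
rewrite -[leLHS]add0r lerD// normrM ler_pM//.
  rewrite (le_trans (ler_normB _ _))// lerD ?cB ?y0//.
  rewrite (le_trans (ler_norm_sum _ _ _))// ler_sum// => l _.
  by rewrite normrM ler_piMr// normrX exprn_ile1// ltW.
rewrite ger0_norm ?invr_ge0 ?(ltW yN0)//.
rewrite -[leRHS]invrK lef_pV2 ?posrE ?invr_gt0 ?exprn_gt0//.
by rewrite -exprVn lerXn2r ?nnegrE ?invr_ge0// ltW.
Qed.

End power_series.

(** * Gegenbauer polynomials and the closed form of the Poisson kernel *)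
Section gegenbauer_expansion.
Context {R : realType}.
Implicit Types (lam t th r : R).

(** The Gegenbauer polynomials by their three-term recurrence, two consecutive
    values at a time; [gegenbauerE] identifies them with the Taylor
    coefficients. *)
Fixpoint gegen_pair lam t (l : nat) : R * R :=
  if l is k.+1 then
    let: (a, b) := gegen_pair lam t k in
    (b, (2 * t * (k.+1%:R + lam) * b - (k%:R + 2 * lam) * a) / k.+2%:R)
  else (1, 2 * lam * t).

Definition gegen lam t l := (gegen_pair lam t l).1.

Lemma gegen0 lam t : gegen lam t 0 = 1. Proof. by []. Qed.

Lemma gegen1 lam t : gegen lam t 1 = 2 * lam * t. Proof. by []. Qed.

Lemma gegenSS lam t l : l.+2%:R * gegen lam t l.+2 =
  2 * t * (l.+1%:R + lam) * gegen lam t l.+1 - (l%:R + 2 * lam) * gegen lam t l.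
Proof.
rewrite /gegen /=; case: (gegen_pair lam t l) => a b /=.
by rewrite mulrC divfK.
Qed.

Lemma cos_mulSS th l : cos (l.+2%:R * th) =
  2 * cos th * cos (l.+1%:R * th) - cos (l%:R * th).
Proof.
have -> : l.+2%:R * th = l.+1%:R * th + th by rewrite -(natr1 l.+1); ring.
have -> : l%:R * th = l.+1%:R * th - th by rewrite -(natr1 l); ring.
by rewrite cosD cosB; ring.
Qed.

(** Coefficientwise form of G' = phi G, where phi = 2 lam (t - r) /
    (1 - 2 t r + r^2) has the Taylor coefficients 2 lam cos((j + 1) th).  Both
    sides satisfy the same second-order linear recurrence, since the cosines
    are annihilated by the operator of coefficients 1, - 2 t, 1. *)
Lemma gegen_cos_sum lam th l : l.+1%:R * gegen lam (cos th) l.+1 =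
  2 * lam * \sum_(k < l.+1) cos ((l.+1 - k)%:R * th) * gegen lam (cos th) k.
Proof.
set g := gegen lam (cos th); set t := cos th.
pose S l := \sum_(k < l.+1) cos ((l.+1 - k)%:R * th) * g k.
have SSS j : S j.+2 = 2 * t * S j.+1 - S j + t * g j.+2 - g j.+1.
  have eS i : S i.+1 = \sum_(k < i.+1) cos ((i.+2 - k)%:R * th) * g k + t * g i.+1.
    by rewrite /S big_ord_recr /= subSnn mul1r.
  rewrite eS big_ord_recr /= eS.
  rewrite (_ : (j.+3 - j.+1 = 2)%N); last lia.
  have -> : \sum_(k < j.+1) cos ((j.+3 - k)%:R * th) * g k =
      2 * t * \sum_(k < j.+1) cos ((j.+2 - k)%:R * th) * g k - S j.
    rewrite mulr_sumr -sumrB; apply: eq_bigr => k _.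
    have kj : (k <= j.+1)%N by have := ltn_ord k; lia.
    rewrite (_ : (j.+3 - k = (j.+1 - k).+2)%N); last lia.
    rewrite (_ : (j.+2 - k = (j.+1 - k).+1)%N); last lia.
    by rewrite cos_mulSS -/t; ring.
  have -> : cos (2 * th) = 2 * t * t - 1.
    by rewrite (cos_mulSS th 0) mul1r mul0r cos0.
  by ring.
rewrite -/(S l).
suff: l.+1%:R * g l.+1 = 2 * lam * S l /\ l.+2%:R * g l.+2 = 2 * lam * S l.+1.
  by case.
elim: l => [|l [ih1 ih2]].
  have S0 : S 0 = t by rewrite /S big_ord1 mul1r /g gegen0 mulr1.
  have S1 : S 1 = 2 * t * t - 1 + t * (2 * lam * t).
    rewrite /S big_ord_recr big_ord1 /= subn0 subSnn mul1r /g gegen0 mulr1.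
    by rewrite gegen1 (cos_mulSS th 0) mul1r mul0r cos0.
  split; first by rewrite S0 mul1r; apply: gegen1.
  by rewrite S1 gegenSS gegen0 gegen1 -/t; ring.
split => //; rewrite SSS gegenSS -/t -/g.
have -> : 2 * lam * (2 * t * S l.+1 - S l + t * g l.+2 - g l.+1) =
  2 * t * (2 * lam * S l.+1) - 2 * lam * S l + 2 * lam * (t * g l.+2 - g l.+1).
  by ring.
rewrite -ih1 -ih2; ring.
Qed.

(** A discrete form of the bound of the sum by an integral; the induction step
    is Bernoulli's inequality a^K (a + K) <= a (a + 1)^K at a = N + 1. *)
Lemma sum_expn_le (K N : nat) : (K * (\sum_(k < N) k.+1 ^ K) <= N * N.+1 ^ K)%N.
Proof.
elim: N => [|N ih]; first by rewrite big_ord0 muln0.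
rewrite big_ord_recr /= mulnDr; apply: leq_trans (leq_add ih (leqnn _)) _.
rewrite -mulnDl.
have bern a : (a ^ K * (a + K) <= a * a.+1 ^ K)%N.
  elim: K {ih} => [|K ih]; first by rewrite mul1n muln1 addn0.
  rewrite !expnS; apply: (@leq_trans (a ^ K * (a + K) * a.+1)); last by nia.
  by rewrite [(a * a ^ K)%N]mulnC -!mulnA leq_mul//; nia.
by apply: leq_trans (bern N.+1); rewrite mulnC leq_mul//; lia.
Qed.

(** Bounding the cosines by 1 in [gegen_cos_sum] leaves the recurrence that
    [sum_expn_le] solves, with any integer exponent above 2 lam. *)
Lemma poly_growth_gegen lam th : 0 <= lam -> poly_growth (gegen lam (cos th)).
Proof.
move=> lam0; pose K := (Num.truncn (2 * lam)).+1.
have lamK : 2 * lam <= K%:R by apply/ltW; rewrite truncnS_gt.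
exists 1, K => l; rewrite mul1r; elim/ltn_ind: l => -[|l] ih.
  by rewrite gegen0 normr1 expr1n.
rewrite -(ler_pM2l (_ : 0 < l.+1%:R)) ?ltr0n//.
rewrite -[X in X * `|_|](@normr_nat R) -normrM gegen_cos_sum normrM.
rewrite ger0_norm ?mulr_ge0//.
apply: (@le_trans _ _ (K%:R * \sum_(k < l.+1) k.+1%:R ^+ K)).
  apply: ler_pM => //; first by rewrite mulr_ge0.
  apply: le_trans (ler_norm_sum _ _ _) _; apply: ler_sum => k _.
  rewrite normrM -[leRHS]mul1r ler_pM//; last exact: ih.
  by rewrite ler_norml cos_geN1 cos_le1.
under eq_bigr do rewrite -natrX.
by rewrite -natr_sum -natrX -!natrM ler_nat sum_expn_le.
Qed.

(** At the pole all cosines in [gegen_cos_sum] equal 1. *)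
Lemma gegen_ge0 lam l : 0 <= lam -> 0 <= gegen lam 1 l.
Proof.
move=> lam0; elim/ltn_ind: l => -[_|l ih]; first exact: ler01.
rewrite -(pmulr_rge0 _ (_ : 0 < l.+1%:R)) ?ltr0n//.
have := gegen_cos_sum lam 0 l; rewrite cos0 => ->.
rewrite mulr_ge0 ?mulr_ge0//.
by apply: sumr_ge0 => k _; rewrite mulr0 cos0 mul1r ih.
Qed.

Lemma gen_quad_gt0 th r : `|r| < 1 -> 0 < 1 - 2 * cos th * r + r ^+ 2.
Proof.
move=> r1; have c1 : `|cos th| <= 1 by rewrite ler_norml cos_geN1 cos_le1.
have h : cos th * r <= `|r|.
  rewrite (le_trans (ler_norm _))// normrM ler_piMl//.
apply: (@lt_le_trans _ _ ((1 - `|r|) ^+ 2)); first by rewrite exprn_gt0 ?subr_gt0.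
have -> : (1 - `|r|) ^+ 2 = 1 - 2 * `|r| + `|r| ^+ 2 by ring.
by rewrite real_normK ?num_real// lerD2r lerD2l lerN2 -mulrA ler_wpM2l.
Qed.

(** Each power series is expanded until both sides are combinations of the
    same ones; the recurrence is then the equality of the coefficients. *)
Lemma gegen_ode lam th r : 0 <= lam -> `|r| < 1 ->
  let G := psum (gegen lam (cos th)) r in
  let G' := psum (pseries_diffs (gegen lam (cos th))) r in
  (1 - 2 * cos th * r + r ^+ 2) * G' = 2 * lam * (cos th - r) * G.
Proof.
move=> lam0 r1 G G'; set t := cos th; pose g := gegen lam t.
have gP : poly_growth g by exact: poly_growth_gegen.
have dP := poly_growth_diffs gP.
have G1 : G = 1 + r * psum (fun l => g l.+1) r by exact: psum_recl.
have E : psum (fun l => l%:R * g l) r = r * G' by exact: psum_natM.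
have D1 : psum (fun l => pseries_diffs g l.+1) r =
    2 * t * G' + 2 * lam * t * psum (fun l => g l.+1) r - 2 * lam * G - r * G'.
  rewrite -E.
  have -> : (fun l => pseries_diffs g l.+1) = (fun l =>
      (2 * t * pseries_diffs g l + 2 * lam * t * g l.+1) +
      (- (2 * lam) * g l + (-1) * (l%:R * g l))).
    apply/funext => l; rewrite /pseries_diffs gegenSS -/g; ring.
  have lP := poly_growth_natM gP; have SP := poly_growthS gP.
  rewrite !psumD ?psumZ//; do ?[exact: poly_growthZ|apply: poly_growthD].
  by rewrite -/G -/G'; ring.
have G'1 : G' = 2 * lam * t + r * psum (fun l => pseries_diffs g l.+1) r.
  by rewrite [LHS]psum_recl// /pseries_diffs mul1r /g gegen1.
have -> : (1 - 2 * t * r + r ^+ 2) * G' = G' - r * (2 * t * G' - r * G') by ring.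
rewrite {1}G'1 D1.
transitivity (2 * lam * t * (1 + r * psum (fun l => g l.+1) r) - 2 * lam * r * G).
  by ring.
by rewrite -G1; ring.
Qed.

Lemma is_derive0_cst_ball (F : R -> R) :
  (forall x : R, `|x| < 1 -> is_derive x (1 : R) F 0) ->
  forall x, `|x| < 1 -> F x = F 0.
Proof.
move=> dF.
have mono (a b : R) : -1 < a -> b < 1 -> a <= b -> F b = F a.
  move=> a1 b1 ab; have D (x : R) : x \in `[a, b] -> is_derive x (1 : R) F 0.
    by rewrite in_itv/= => /andP[ax xb]; apply: dF; rewrite ltr_norml; lra.
  have cF : {within `[a, b], continuous F}.
    by apply: derivable_within_continuous => x /D[].
  have dF0 (x : R) : x \in `]a, b[ -> is_derive x (1 : R) F ((cst 0 : R -> R) x).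
    by move=> /subset_itv_oo_cc/D.
  have [c _] := MVT_segment ab dF0 cF.
  by rewrite mul0r => /eqP; rewrite subr_eq0 => /eqP.
move=> x; rewrite ltr_norml => /andP[x1 x2].
have [x0|/ltW x0] := leP 0 x; first by apply: mono => //; lra.
by apply/esym/mono => //; lra.
Qed.

(** The product of G and (1 - 2 t r + r^2)^lam has derivative 0 by
    [gegen_ode] and value 1 at r = 0. *)
Lemma gegen_generating lam th r : 0 < lam -> `|r| < 1 ->
  (1 - 2 * cos th * r + r ^+ 2) `^ (- lam) = psum (gegen lam (cos th)) r.
Proof.
move=> lam0 r1; set t := cos th; pose g := gegen lam t.
have gP : poly_growth g by apply/poly_growth_gegen/ltW.
pose q x : R := 1 - 2 * t * x + x ^+ 2.
pose F x := psum g x * q x `^ lam.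
have q0 (x : R) : `|x| < 1 -> 0 < q x by exact: gen_quad_gt0.
have dF (x : R) : `|x| < 1 -> is_derive x (1 : R) F 0.
  move=> x1; have dg := is_derive_psum gP x1.
  have dq : is_derive x (1 : R) q (2 * x - 2 * t).
    apply: is_derive_eq; rewrite /GRing.scale /=; ring.
  have dp := @is_derive1_comp _ _ _ _ _ _ (is_derive1_powR lam (q0 _ x1)) dq.
  have /= dF := is_deriveM dg dp.
  apply: (@is_derive_eq _ _ _ _ _ _ _ _ dF); rewrite /GRing.scale /=.
  rewrite -(mulr_powRB1 (ltW (q0 _ x1)) lam0).
  have := gegen_ode th (ltW lam0) x1; rewrite -/t -/g -/(q x) => /= ode.
  set p := q x `^ (lam - 1).
  move: ode; set G := psum g x; set G' := psum _ x => ode.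
  transitivity (p * (G * (lam * (2 * x - 2 * t)) + q x * G')); first by ring.
  by rewrite ode; ring.
have F1 : F r = F 0 by exact: is_derive0_cst_ball dF _ r1.
have F0 : F 0 = 1.
  by rewrite /F psum0 /q mulr0 subr0 expr0n /= addr0 powR1 mulr1.
have qN0 : q r `^ lam != 0 by rewrite gt_eqF// powR_gt0//; exact: q0.
rewrite -/(q r) powRN; apply: (mulIf qN0).
by rewrite mulVf// -[RHS]/(F r) F1 F0.
Qed.

Lemma gegenbauerE lam th l : 0 < lam ->
  gegenbauer lam l (cos th) = gegen lam (cos th) l.
Proof.
move=> lam0; apply: taylor_coef_psum; first exact/poly_growth_gegen/ltW.
by move=> r; exact: gegen_generating.
Qed.

Lemma poly_growth_zonal lam th : 0 < lam ->
  poly_growth (fun l => zonal_harmonic lam l (cos th)).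
Proof.
move=> lam0; rewrite /zonal_harmonic.
under eq_fun do rewrite gegenbauerE//.
have := poly_growthM (poly_growth_linear lam^-1 1) (poly_growth_gegen th (ltW lam0)).
congr poly_growth; apply/funext => l; congr (_ * _).
by rewrite addrC mulrDl divff ?gt_eqF// mulrC.
Qed.

Lemma zonal_harmonic_ge0 lam l : 0 < lam -> 0 <= zonal_harmonic lam l 1.
Proof.
move=> lam0; rewrite -[X in zonal_harmonic _ _ X](@cos0 R) /zonal_harmonic.
have l0 := ltW lam0.
by rewrite gegenbauerE// cos0 mulr_ge0 ?gegen_ge0// divr_ge0 ?addr_ge0.
Qed.

(** The factor (lam + l) / lam turns G into G + r G' / lam, and [gegen_ode]
    eliminates G'. *)
Lemma psum_zonal lam th r : 0 < lam -> `|r| < 1 ->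
  psum (fun l => zonal_harmonic lam l (cos th)) r =
  (1 - r ^+ 2) / (1 - 2 * cos th * r + r ^+ 2) `^ (lam + 1).
Proof.
move=> lam0 r1; set t := cos th; pose g := gegen lam t.
have gP : poly_growth g by exact/poly_growth_gegen/ltW.
have q0 : 0 < 1 - 2 * t * r + r ^+ 2 by exact: gen_quad_gt0.
have := gegen_ode th (ltW lam0) r1; rewrite -/t -/g /= => ode.
have := gegen_generating th lam0 r1; rewrite -/t -/g => G.
have -> : psum (fun l => zonal_harmonic lam l t) r =
    psum g r + lam^-1 * (r * psum (pseries_diffs g) r).
  rewrite -psum_natM// -psumZ//; last exact: poly_growth_natM.
  rewrite -psumD//; last exact/poly_growthZ/poly_growth_natM.
  congr psum; apply/funext => l.
  rewrite /zonal_harmonic gegenbauerE// mulrDl divff ?gt_eqF// mulrDl mul1r.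
  by rewrite mulrA [l%:R / _]mulrC.
move: G ode q0; set q := 1 - _ + _ => G ode q0.
have E : psum (pseries_diffs g) r = 2 * lam * (t - r) * psum g r / q.
  by rewrite -ode mulrAC divff ?mul1r// gt_eqF.
have qN0 : q != 0 by rewrite gt_eqF.
have qD : q `^ (lam + 1) = q `^ lam * q.
  by rewrite powRD ?qN0 ?implybT// (powRr1 (ltW q0)).
rewrite E qD invfM -powRN G.
have lN0 : lam != 0 by rewrite gt_eqF.
rewrite -[X in X + _](mulfK qN0) (_ : (1 - r ^+ 2) = q + 2 * r * (t - r)).
  field; exact/andP.
by rewrite /q; ring.
Qed.

End gegenbauer_expansion.

(** * Abel summation *)
Section abel_theorem.
Context {R : realType}.
Implicit Types (u : R^nat) (c e x : R) (S : \bar R).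

Definition abel_cvg u :=
  forall x, 0 <= x < 1 -> cvgn (series (fun l => u l * x ^+ l)).

Definition abel_mean u x := limn (series (fun l => u l * x ^+ l)).

(** Summation by parts; subtracting c from the partial sums is free because
    (1 - x) times the sum of the x^l for l < N is 1 - x^N. *)
Lemma series_by_parts u c x N : series (fun l => u l * x ^+ l) N - c =
  (1 - x) * (\sum_(0 <= l < N) (series u l.+1 - c) * x ^+ l) +
  (series u N - c) * x ^+ N.
Proof.
rewrite /series /=; elim: N => [|N ih].
  by rewrite !big_geq// mulr0 !add0r expr0 mulr1.
rewrite !(@big_nat_recr _ _ _ N)//= exprS addrAC ih; ring.
Qed.

(** One-sided form of Abel's theorem.  In [series_by_parts] all terms past
    some rank are nonnegative, and the finitely many others carry the factor
    1 - x.  It serves finite and infinite sums alike. *)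
Lemma abel_mean_ge u c e : abel_cvg u ->
  (\forall N \near \oo, c <= series u N) -> 0 < e ->
  \forall x \near 1^'-, c - e <= abel_mean u x.
Proof.
move=> ucvg [N0 _ uc] e0.
pose M : R := \sum_(0 <= l < N0) `|series u l.+1 - c|.
have M0 : 0 <= M by exact: sumr_ge0.
near=> x.
have x0 : 0 <= x by near: x; apply: nbhs_left_ge.
have x1 : x < 1 by near: x; exact: nbhs_left_lt.
have x1' : 0 <= 1 - x by rewrite subr_ge0 ltW.
have xM : (1 - x) * (M + 1) <= e.
  rewrite -ler_pdivlMr ?ltr_wpDl// lerBlDr -lerBlDl.
  by near: x; apply: nbhs_left_ge; rewrite ltrBlDr ltrDl divr_gt0// ltr_wpDl.
apply: limr_ge; first by apply: ucvg; rewrite x0.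
near=> N; rewrite -(subrK c (series _ N)) addrC lerD2r series_by_parts.
have N0N : (N0 <= N)%N by near: N; exact: nbhs_infty_ge.
apply: (@le_trans _ _ (- ((1 - x) * M))).
  by rewrite lerN2 (le_trans _ xM)// ler_wpM2l// lerDl.
rewrite -mulrN -[leLHS]addr0 lerD//; last first.
  by rewrite mulr_ge0 ?exprn_ge0// subr_ge0 uc.
rewrite ler_wpM2l// (big_cat_nat (leq0n N0) N0N)/=.
rewrite -[leLHS]addr0 lerD//; last first.
  rewrite big_nat sumr_ge0// => l /andP[N0l _].
  rewrite mulr_ge0 ?exprn_ge0// subr_ge0 uc//; exact: leqW.
rewrite -sumrN; apply: ler_sum => l _.
rewrite lerNl -mulNr (le_trans (ler_norm _))// normrM normrN ger0_norm ?exprn_ge0//.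
by rewrite ler_piMr// exprn_ile1// ltW.
Unshelve. all: by end_near. Qed.

Lemma abel_meanN u x : abel_cvg u -> 0 <= x < 1 ->
  abel_mean (fun l => - u l) x = - abel_mean u x.
Proof.
move=> ucvg x01; apply/cvg_lim => //.
rewrite (_ : series _ = - series (fun l => u l * x ^+ l)); first by apply: cvgN; exact: ucvg.
apply/funext => N; rewrite /series /= !fctE -sumrN.
by apply: eq_bigr => l _; rewrite mulNr.
Qed.

Lemma abel_cvgN u : abel_cvg u -> abel_cvg (fun l => - u l).
Proof.
move=> ucvg x x01.
rewrite (_ : series _ = - series (fun l => u l * x ^+ l)); first by apply: is_cvgN; exact: ucvg.
apply/funext => N; rewrite /series /= !fctE -sumrN.
by apply: eq_bigr => l _; rewrite mulNr.
Qed.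

Lemma abel_mean_le u c e : abel_cvg u ->
  (\forall N \near \oo, series u N <= c) -> 0 < e ->
  \forall x \near 1^'-, abel_mean u x <= c + e.
Proof.
move=> ucvg uc e0.
have : \forall N \near \oo, - c <= series (fun l => - u l) N.
  by near do rewrite /series /= sumrN lerN2.
move=> /(abel_mean_ge (abel_cvgN ucvg)) /(_ e0) H.
near=> x; rewrite -lerN2 opprD -abel_meanN//; first by near: x.
by apply/andP; split; near: x; [exact: nbhs_left_ge|exact: nbhs_left_lt].
Unshelve. all: by end_near. Qed.

Lemma abel_theorem u S : abel_cvg u -> has_sum u S ->
  (abel_mean u x)%:E @[x --> (1 : R)^'-] --> S.
Proof.
move=> ucvg; rewrite /has_sum; case: S => [s||] us.
- have {}us : series u @ \oo --> s by exact: (fine_cvg us).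
  apply: cvg_EFin; first exact: nearW.
  apply/cvgrPdist_le => e e0; have e20 : 0 < e / 2 by rewrite divr_gt0.
  have lo : \forall N \near \oo, s - e / 2 <= series u N.
    by apply: (cvgr_ge _ us); rewrite ltrBlDr ltrDl.
  have hi : \forall N \near \oo, series u N <= s + e / 2.
    by apply: (cvgr_le _ us); rewrite ltrDl.
  near=> x; rewrite ler_distlC; apply/andP; split.
    rewrite [e]splitr opprD addrA; near: x; exact: abel_mean_ge.
  rewrite [e]splitr addrA; near: x; exact: abel_mean_le.
- apply/cvgeyPge => A; have lo : \forall N \near \oo, A + 1 <= series u N.
    by have /cvgeyPge/(_ (A + 1)) := us; apply: filterS => N; rewrite lee_fin.
  by have := abel_mean_ge ucvg lo ltr01; rewrite addrK; apply: filterS.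
- apply/cvgeNyPle => A; have hi : \forall N \near \oo, series u N <= A - 1.
    by have /cvgeNyPle/(_ (A - 1)) := us; apply: filterS => N; rewrite lee_fin.
  by have := abel_mean_le ucvg hi ltr01; rewrite subrK; apply: filterS.
Unshelve. all: by end_near. Qed.

Lemma series_shift u x N M : series (fun l => u l * x ^+ l) (M + N)%N =
  \sum_(0 <= l < N) u l * x ^+ l +
  x ^+ N * series (fun l => u (l + N)%N * x ^+ l) M.
Proof.
rewrite /series /= (big_cat_nat (leq0n N) (leq_addl M N)) /=; congr (_ + _).
rewrite -{1}[N]add0n big_addn addnK mulr_sumr; apply: eq_bigr => l _.
by rewrite exprD mulrA mulrC.
Qed.

Lemma abel_mean_shift u x N : abel_cvg (fun l => u (l + N)%N) -> 0 <= x < 1 ->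
  series (fun l => u l * x ^+ l) @ \oo -->
    \sum_(0 <= l < N) u l * x ^+ l + x ^+ N * abel_mean (fun l => u (l + N)%N) x.
Proof.
move=> vcvg x01; rewrite -(cvg_shiftn N).
under eq_fun do rewrite series_shift.
by apply: cvgD; [exact: cvg_cst|apply: cvgMl_tmp; exact: vcvg].
Qed.

Lemma abel_cvg_shift u N : abel_cvg (fun l => u (l + N)%N) -> abel_cvg u.
Proof. by move=> vcvg x x01; have /cvgP := abel_mean_shift vcvg x01. Qed.

Lemma has_abel_sum_shift u N I : abel_cvg (fun l => u (l + N)%N) ->
  (abel_mean (fun l => u (l + N)%N) x)%:E @[x --> (1 : R)^'-] --> I%:E ->
  has_abel_sum u (I + \sum_(0 <= l < N) u l)%:E.
Proof.
move=> vcvg /fine_cvg vI; split; first exact: abel_cvg_shift vcvg.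
apply: cvg_EFin; first exact: nearW.
have cX l : (x ^+ l) @[x --> (1 : R)^'-] --> (1 : R).
  by have := cvg_at_left_filter (@exprn_continuous R l 1); rewrite expr1n.
have csum M : \sum_(0 <= l < M) u l * x ^+ l @[x --> (1 : R)^'-] -->
    \sum_(0 <= l < M) u l.
  elim: M => [|M ih].
    by rewrite big_geq//; under eq_fun do rewrite big_geq//; exact: cvg_cst.
  rewrite big_nat_recr//=; under eq_fun do rewrite big_nat_recr//=.
  by apply: cvgD => //; rewrite -[X in _ --> X]mulr1; apply: cvgMl_tmp.
have lim : \sum_(0 <= l < N) u l * x ^+ l +
    x ^+ N * abel_mean (fun l => u (l + N)%N) x @[x --> (1 : R)^'-] -->
    \sum_(0 <= l < N) u l + 1 * I by apply: cvgD => //; apply: cvgM.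
rewrite addrC; rewrite mul1r in lim; apply: cvg_trans lim.
apply: near_eq_cvg; near=> x; apply/esym/cvg_lim => //.
apply: abel_mean_shift => //; apply/andP; split; near: x.
  exact: nbhs_left_ge.
exact: nbhs_left_lt.
Unshelve. all: by end_near. Qed.

Lemma has_sum_shift u N S : has_sum (fun l => u (l + N)%N) S ->
  has_sum u (S + (\sum_(0 <= l < N) u l)%:E)%E.
Proof.
rewrite /has_sum => vS; rewrite -(cvg_shiftn N).
rewrite (_ : (fun n => _) = (fun M => (series (fun l => u (l + N)%N) M)%:E +
    (\sum_(0 <= l < N) u l)%:E)%E).
  by apply: cvgeD; [exact: fin_num_adde_defl|exact: vS|exact: cvg_cst].
apply/funext => M; rewrite -EFinD /series /=.
rewrite (big_cat_nat (leq0n N) (leq_addl M N)) /= addrC; congr (_ + _)%:E.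
by rewrite -{1}[N]add0n big_addn addnK.
Qed.

End abel_theorem.

(** * The weight and its moments *)
Section improper_ftc.
Context {R : realType}.
Notation mu := (@lebesgue_measure R).

(** The weight is unbounded near 0, so the moments are improper integrals.
    The nonnegativity of f lets the integrals over an increasing sequence of
    compact intervals converge to the integral over the open one. *)
Lemma ge0_improper_FTC2 (f F : R -> R) (a b l0 l1 : R) : a < b ->
  (forall x, a < x < b -> 0 <= f x) ->
  (forall x, a < x < b -> {for x, continuous f}) ->
  (forall x, a < x < b -> is_derive x (1 : R) F (f x)) ->
  F x @[x --> a^'+] --> l0 -> F x @[x --> b^'-] --> l1 ->
  (\int[mu]_(x in `]a, b[) (f x)%:E = (l1 - l0)%:E)%E.
Proof.
move=> ab f0 cf dF Fa Fb.
(* With denominators at least 3 the intervals [a + h k, b - h k] have a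
   nonempty interior. *)
pose h (k : nat) : R := (b - a) / k.+3%:R.
have ba0 : 0 < b - a by rewrite subr_gt0.
have h0 k : 0 < h k by rewrite divr_gt0.
have hdec k m : (k <= m)%N -> h m <= h k.
  by move=> km; rewrite ler_pM2l// lef_pV2 ?posrE// ler_nat.
have hlt k : a + h k < b - h k.
  have : h k + h k < b - a.
    rewrite -mulrDr gtr_pMr// -mulr2n -(mulr_natl _ 2) ltr_pdivrMr// mul1r ltr_nat.
    by [].
  by lra.
have hcvg : h @ \oo --> 0.
  rewrite -(mulr0 (b - a)); apply: cvgMl_tmp.
  have := @cvg_harmonic R; rewrite -(cvg_shiftn 2).
  by under eq_fun do rewrite addn2.
pose I k := `[a + h k, b - h k]%classic.
have Iab k x : I k x -> a < x < b.
  by rewrite /I /= in_itv/= => /andP[x1 x2]; have := h0 k; lra.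
have IE : \bigcup_k I k = `]a, b[%classic.
  apply/seteqP; split => [x [k _] /Iab|x]; rewrite /= in_itv//= => /andP[ax xb].
  have : \forall k \near \oo, h k < Num.min (x - a) (b - x).
    by apply: (cvgr_lt _ hcvg); rewrite lt_min !subr_gt0 ax.
  case=> k _ /(_ k (leqnn k)) /=; rewrite lt_min => /andP[h1 h2].
  by exists k => //=; rewrite /I /= in_itv/=; lra.
have Icvg : (fun k => \int[mu]_(x in I k) (f x)%:E)%E @ \oo -->
    (\int[mu]_(x in `]a, b[) (f x)%:E)%E.
  rewrite -IE; apply: ge0_nondecreasing_set_cvg_integral => //.
  - move=> k m km; apply/subsetPset => x; rewrite /I /= !in_itv/= => /andP[x1 x2].
    by have := hdec _ _ km; lra.
  - by move=> k; exact: measurable_itv.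
  - move=> k; apply/measurable_EFinP; apply: subspace_continuous_measurable_fun.
      exact: measurable_itv.
    by apply: continuous_in_subspaceT => x /set_mem/Iab/cf.
  - by move=> k x /Iab xab; rewrite lee_fin f0.
have IF k : (\int[mu]_(x in I k) (f x)%:E = (F (b - h k) - F (a + h k))%:E)%E.
  rewrite EFinB; apply: continuous_FTC2 => //.
  - by apply: continuous_in_subspaceT => x /set_mem/Iab/cf.
  - have dFk x : x \in `[a + h k, b - h k] -> derivable F x 1.
      by move=> /Iab/dF[].
    have : {within `[a + h k, b - h k], continuous F}.
      exact: derivable_within_continuous.
    move=> /(continuous_within_itvP _ (hlt k))[_ Fl Fr]; split => //.
    by move=> x /subset_itv_oo_cc/dFk.
  - by move=> x /subset_itv_oo_cc/Iab/dF[_ <-]; rewrite derive1E.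
have IFcvg : (fun k => (F (b - h k) - F (a + h k))%:E) @ \oo --> (l1 - l0)%:E.
  apply: cvg_EFin; first exact: nearW.
  apply: cvgB.
    apply: (cvg_at_leftP _ _ _).1 Fb _ _; split; first by move=> k; rewrite ltrBlDr ltrDl.
    by rewrite -[X in _ --> X]subr0; apply: cvgB => //; exact: cvg_cst.
  apply: (cvg_at_rightP _ _ _).1 Fa _ _; split; first by move=> k; rewrite ltrDl.
  by rewrite -[X in _ --> X]addr0; apply: cvgD => //; exact: cvg_cst.
move: Icvg; under eq_fun do rewrite IF.
move=> Icvg; exact: (cvg_unique (@ereal_hausdorff R) Icvg IFcvg).
Qed.

End improper_ftc.

Section hyperbolic_kernels.
Context {R : realType}.
Implicit Types (s m b r : R).

(** sinh(s ln r) / s, a function of s^2 that is analytic also at s = 0. *)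
Definition sinh_ln s r : R :=
  if s == 0 then ln r else (r `^ s - r `^ (- s)) / (2 * s).

(** cosh(s ln r). *)
Definition cosh_ln s r : R := (r `^ s + r `^ (- s)) / 2.

Lemma powRD_gt0 r s m : 0 < r -> r `^ (s + m) = r `^ s * r `^ m.
Proof. by move=> r0; rewrite powRD// (gt_eqF r0) implybT. Qed.

Lemma is_derive_powR s r : 0 < r ->
  is_derive r (1 : R) (fun x => x `^ s) (s * r `^ s / r).
Proof.
move=> r0; have := is_derive1_powR s r0.
by rewrite powRD_gt0// powRN (powRr1 (ltW r0)) mulrA.
Qed.

Lemma is_derive_sinh_ln s r : 0 < r ->
  is_derive r (1 : R) (sinh_ln s) (cosh_ln s r / r).
Proof.
move=> r0; rewrite /sinh_ln /cosh_ln; have [->|s0] := eqVneq s 0.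
  by rewrite oppr0 powRr0 -mulr2n divff ?pnatr_eq0// div1r; exact: is_derive1_ln.
have d1 := is_derive_powR s r0; have d2 := is_derive_powR (- s) r0.
apply: is_derive_eq; rewrite /GRing.scale /=.
have rN0 : r != 0 by rewrite gt_eqF.
by field; exact/andP.
Qed.

Lemma is_derive_cosh_ln s r : 0 < r ->
  is_derive r (1 : R) (cosh_ln s) (s ^+ 2 * sinh_ln s r / r).
Proof.
move=> r0; rewrite /cosh_ln.
have d1 := is_derive_powR s r0; have d2 := is_derive_powR (- s) r0.
apply: is_derive_eq; rewrite /GRing.scale /= /sinh_ln.
have rN0 : r != 0 by rewrite gt_eqF.
have [->|s0] := eqVneq s 0; first by rewrite expr0n /= !(mul0r, oppr0, addr0, mulr0).
by field; exact/andP.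
Qed.

Lemma cosh_ln_ge s m r : 0 < r <= 1 -> 0 <= s <= m -> cosh_ln s r <= cosh_ln m r.
Proof.
move=> /andP[r0 r1] /andP[s0 sm].
have m0 : 0 <= m by exact: le_trans sm.
rewrite /cosh_ln ler_pM2r ?invr_gt0// !powRN.
set p := r `^ s; set P := r `^ m.
have P0 : 0 < P by rewrite powR_gt0.
have p0 : 0 < p by rewrite powR_gt0.
have Pp : P <= p by rewrite ger_powR ?r0.
have p1 : p <= 1 by rewrite -(powRr0 r) ger_powR ?r0.
have PN0 : P != 0 by rewrite gt_eqF.
have pN0 : p != 0 by rewrite gt_eqF.
rewrite -subr_ge0 (_ : _ - _ = (p - P) * (1 - P * p) / (P * p)).
  have Pp1 : P * p <= 1 by rewrite mulr_ile1 ?(ltW P0) ?(ltW p0)//; exact: le_trans p1.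
  by rewrite divr_ge0 ?mulr_ge0 ?subr_ge0 ?(ltW P0) ?(ltW p0).
by field; exact/andP.
Qed.

Lemma sinh_ln1 s : sinh_ln s 1 = 0.
Proof. by rewrite /sinh_ln ln1 !powR1 subrr mul0r if_same. Qed.

(** On ]0, 1] the logarithm is nonpositive, so this says that sinh(s x) / s
    increases with s at x = - ln r.  The difference vanishes at r = 1 and its
    derivative has constant sign by [cosh_ln_ge]. *)
Lemma sinh_ln_le s m r : 0 < r <= 1 -> 0 <= s <= m -> sinh_ln m r <= sinh_ln s r.
Proof.
move=> /andP[r0 r1] sm.
pose f x := sinh_ln s x - sinh_ln m x.
pose df x := (cosh_ln s x - cosh_ln m x) / x.
have dF (x : R) : 0 < x -> is_derive x (1 : R) f (df x).
  move=> x0; have d1 := is_derive_sinh_ln s x0; have d2 := is_derive_sinh_ln m x0.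
  by apply: is_derive_eq; rewrite /df mulrBl.
have f1 : f 1 = 0 by rewrite /f !sinh_ln1 subrr.
have dF' (x : R) : x \in `]r, 1[ -> is_derive x (1 : R) f (df x).
  by rewrite in_itv/= => /andP[rx _]; apply: dF; exact: lt_trans rx.
have cf : {within `[r, 1], continuous f}.
  apply: derivable_within_continuous => x; rewrite in_itv/= => /andP[rx _].
  by have [] := dF x (lt_le_trans r0 rx).
have [c] := MVT_segment r1 dF' cf.
rewrite in_itv/= f1 sub0r => /andP[rc c1] /eqP; rewrite eqr_oppLR => /eqP fr.
rewrite -subr_ge0 -/(f r) fr oppr_ge0 mulr_le0_ge0 ?subr_ge0//.
have c0 : 0 < c by exact: lt_le_trans rc.
by rewrite /df mulr_le0_ge0 ?invr_ge0 ?(ltW c0)// subr_le0 cosh_ln_ge// c0.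
Qed.

(** From ln y < y at y = r^(- b / 2): the logarithm costs only half of the
    exponent. *)
Lemma powR_ln_cvg0 b : 0 < b -> r `^ b * ln r @[r --> (0 : R)^'+] --> 0.
Proof.
move=> b0; have b20 : 0 < b / 2 by rewrite divr_gt0.
rewrite -[X in _ --> X]oppr0.
under eq_fun do rewrite -[_ * _]opprK.
apply: cvgN.
apply: (@squeeze_cvgr _ _ _ _ (cst 0) (fun r => (b / 2)^-1 * r `^ (b / 2))).
- near=> r; have r0 : 0 < r by near: r; exact: nbhs_right_gt.
  have r1 : r < 1 by near: r; exact: nbhs_right_lt.
  rewrite -mulrN mulr_ge0 ?powR_ge0 ?oppr_ge0 ?ln_le0 ?(ltW r1)//=.
  have p0 : 0 < r `^ (- (b / 2)) by rewrite powR_gt0.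
  have := ltW (ln_sublinear p0); rewrite ln_powR => h.
  have -> : r `^ b = r `^ (b / 2) * r `^ (b / 2) by rewrite -powRD_gt0// -splitr.
  rewrite ler_pdivlMl//.
  have -> : b / 2 * (r `^ (b / 2) * r `^ (b / 2) * - ln r) =
     r `^ (b / 2) * r `^ (b / 2) * (- (b / 2) * ln r) by ring.
  apply: le_trans (ler_wpM2l _ h) _; first by rewrite mulr_ge0// powR_ge0.
  by rewrite -mulrA -powRD_gt0// subrr powRr0 mulr1.
- exact: cvg_cst.
- by rewrite -[X in _ --> X](mulr0 (b / 2)^-1); apply: cvgMl_tmp; exact: powR_cvg0.
Unshelve. all: by end_near. Qed.

Lemma powR_cosh_ln_cvg0 b s : `|s| < b ->
  r `^ b * cosh_ln s r @[r --> (0 : R)^'+] --> 0.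
Proof.
rewrite ltr_norml => /andP[sb1 sb2].
have H : (r `^ (b + s) + r `^ (b - s)) / 2 @[r --> (0 : R)^'+] --> 0.
  rewrite -[X in _ --> X](mul0r 2^-1); apply: cvgMr_tmp; rewrite -[X in _ --> X]addr0.
  by apply: cvgD; apply: powR_cvg0; lra.
apply: cvg_trans H; apply: near_eq_cvg; near=> r.
have r0 : 0 < r by near: r; exact: nbhs_right_gt.
by rewrite /cosh_ln !powRD_gt0// -mulrDr mulrA.
Unshelve. all: by end_near. Qed.

Lemma powR_sinh_ln_cvg0 b s : `|s| < b ->
  r `^ b * sinh_ln s r @[r --> (0 : R)^'+] --> 0.
Proof.
move=> sb; have b0 : 0 < b by exact: le_lt_trans sb.
rewrite /sinh_ln; have [_|s0] := eqVneq s 0; first exact: powR_ln_cvg0.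
move: sb; rewrite ltr_norml => /andP[sb1 sb2].
have H : (r `^ (b + s) - r `^ (b - s)) / (2 * s) @[r --> (0 : R)^'+] --> 0.
  rewrite -[X in _ --> X](mul0r (2 * s)^-1); apply: cvgMr_tmp; rewrite -[X in _ --> X]subr0.
  by apply: cvgB; apply: powR_cvg0; lra.
apply: cvg_trans H; apply: near_eq_cvg; near=> r.
have r0 : 0 < r by near: r; exact: nbhs_right_gt.
by rewrite !powRD_gt0// -mulrBr mulrA.
Unshelve. all: by end_near. Qed.

(** A primitive of r^(b - 1) sinh(s ln r) / s, found by integrating by parts
    twice; it needs no case distinction on s. *)
Definition sinh_ln_primitive b s r : R :=
  r `^ b * (b * sinh_ln s r - cosh_ln s r) / (b ^+ 2 - s ^+ 2).

Lemma is_derive_sinh_ln_primitive b s r : `|s| < b -> 0 < r ->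
  is_derive r (1 : R) (sinh_ln_primitive b s) (r `^ (b - 1) * sinh_ln s r).
Proof.
move=> sb r0; have D0 : b ^+ 2 - s ^+ 2 != 0.
  by rewrite gt_eqF// subr_gt0 -(real_normK (num_real s)) ltrXn2r// ?nnegrE// (le_trans _ (ltW sb)).
have d0 := is_derive_powR b r0.
have d1 := is_derive_sinh_ln s r0; have d2 := is_derive_cosh_ln s r0.
rewrite /sinh_ln_primitive; apply: is_derive_eq; rewrite /GRing.scale /=.
rewrite powRD_gt0// powRN (powRr1 (ltW r0)).
have rN0 : r != 0 by rewrite gt_eqF.
by field; exact/andP.
Qed.

Lemma sinh_ln_primitive1 b s : sinh_ln_primitive b s 1 = - (b ^+ 2 - s ^+ 2)^-1.
Proof.
by rewrite /sinh_ln_primitive sinh_ln1 /cosh_ln !powR1 divff// mulr0 sub0r mul1r mulN1r.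
Qed.

Lemma sinh_ln_primitive_cvg0 b s : `|s| < b ->
  sinh_ln_primitive b s r @[r --> (0 : R)^'+] --> 0.
Proof.
move=> sb; pose f r := b * (r `^ b * sinh_ln s r) - r `^ b * cosh_ln s r.
have f0 : f r @[r --> (0 : R)^'+] --> b * 0 - 0.
  apply: cvgB; last exact: powR_cosh_ln_cvg0.
  by apply: cvgMl_tmp; exact: powR_sinh_ln_cvg0.
rewrite mulr0 subr0 in f0.
rewrite (_ : sinh_ln_primitive b s = fun r => f r / (b ^+ 2 - s ^+ 2)).
  by rewrite -[X in _ --> X](mul0r (b ^+ 2 - s ^+ 2)^-1); apply: cvgMr_tmp.
by apply/funext => r; rewrite /sinh_ln_primitive /f mulrBr mulrCA.
Qed.

Lemma sinh_ln_primitive_cvg1 b s : `|s| < b ->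
  sinh_ln_primitive b s r @[r --> (1 : R)^'-] --> - (b ^+ 2 - s ^+ 2)^-1.
Proof.
move=> sb; rewrite -sinh_ln_primitive1; apply: cvg_at_left_filter.
have [+ _] := is_derive_sinh_ln_primitive sb ltr01.
by move=> /derivable1_diffP/differentiable_continuous.
Qed.

End hyperbolic_kernels.

Section green_weight_moments.
Context {R : realType}.
Implicit Types (lam L a r : R) (n l : nat).
Notation leb := (@lebesgue_measure R).

Lemma gorder_gt0 n : (2 <= n)%N -> 0 < gorder n :> R.
Proof.
by move=> n2; rewrite /gorder divr_gt0// subr_gt0 ltr1n.
Qed.

(** The upper bound on L says that L + lam <= sqrt 2 lam, which makes the
    radicand 2 lam^2 - (L + lam)^2 nonnegative. *)
Lemma discr_root_sqr lam L : 0 < lam -> 0 < L <= (Num.sqrt 2 - 1) * lam ->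
  discr_root lam L ^+ 2 = lam ^+ 2 - 2 * L * lam - L ^+ 2.
Proof.
move=> lam0 /andP[L0 Llam]; rewrite sqr_sqrtr//.
have h : L + lam <= Num.sqrt 2 * lam by lra.
have : (L + lam) ^+ 2 <= (Num.sqrt 2 * lam) ^+ 2.
  by rewrite lerXn2r// nnegrE ?mulr_ge0 ?sqrtr_ge0//; lra.
by rewrite exprMn sqr_sqrtr//; nra.
Qed.

Lemma discr_root_lt lam L : 0 < lam -> 0 < L <= (Num.sqrt 2 - 1) * lam ->
  0 <= discr_root lam L < L + lam.
Proof.
move=> lam0 hL; rewrite sqrtr_ge0 /= -(@ltr_pXn2r _ 2)// ?nnegrE ?sqrtr_ge0//.
  by rewrite discr_root_sqr//; case/andP: hL => L0 _; nra.
by case/andP: hL => L0 _; lra.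
Qed.

(** The weight rewritten so that both cases of [termB] have the same form;
    the A-terms are the hyperbolic sine with parameter L + lam. *)
Definition weight lam L r : R := (2 * L * (L + 2 * lam))^-1 * (r `^ (lam - 1) *
  (sinh_ln (discr_root lam L) r - sinh_ln (L + lam) r)).

Lemma green_weightE lam L r : 0 < lam -> 0 < L -> 0 < r ->
  green_weight lam L r = weight lam L r.
Proof.
move=> lam0 L0 r0; rewrite /green_weight /weight /coefA /termB /coefB.
have mN0 : L + lam != 0 by rewrite gt_eqF// addr_gt0.
have kN0 : L + 2 * lam != 0 by rewrite gt_eqF// addr_gt0// mulr_gt0.
have LN0 : L != 0 by rewrite gt_eqF.
rewrite {2}/sinh_ln (negbTE mN0).
have -> : - L - 1 = (lam - 1) + - (L + lam) by ring.
have -> : L + 2 * lam - 1 = (lam - 1) + (L + lam) by ring.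
rewrite !(@powRD_gt0 _ r (lam - 1))//.
rewrite /sinh_ln; set s := discr_root lam L; case: ifPn => s0.
  by field; rewrite LN0 kN0 mN0.
have -> : lam + s - 1 = (lam - 1) + s by ring.
have -> : lam - s - 1 = (lam - 1) + - s by ring.
rewrite !(@powRD_gt0 _ r (lam - 1))//.
by field; rewrite LN0 kN0 mN0 s0.
Qed.

Lemma weight_ge0 lam L r : 0 < lam -> 0 < L <= (Num.sqrt 2 - 1) * lam ->
  0 < r <= 1 -> 0 <= weight lam L r.
Proof.
move=> lam0 hL r01; have /andP[s0 sm] := discr_root_lt lam0 hL.
case/andP: hL => L0 _; rewrite /weight mulr_ge0//.
  by rewrite invr_ge0 !mulr_ge0 ?addr_ge0 ?mulr_ge0// ltW.
by rewrite mulr_ge0 ?powR_ge0// subr_ge0 sinh_ln_le// s0 ltW.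
Qed.

Lemma continuous_weight lam L r : 0 < r -> {for r, continuous (weight lam L)}.
Proof.
move=> r0; have d0 := is_derive_powR (lam - 1) r0.
have d1 := is_derive_sinh_ln (discr_root lam L) r0.
have d2 := is_derive_sinh_ln (L + lam) r0.
have cont f df : is_derive r (1 : R) f df -> {for r, continuous f}.
  by case=> d _; exact/differentiable_continuous/derivable1_diffP.
apply: cvgMl_tmp; apply: cvgM; first exact: cont d0.
by apply: cvgB; [exact: cont d1|exact: cont d2].
Qed.

(** The primitives of the two hyperbolic sines contribute
    1 / (b^2 - m^2) - 1 / (b^2 - s^2) with b = l + lam; the prefactor of the
    weight is 1 / (m^2 - s^2), so only the product of the two denominators
    remains.  The condition L < l is b > m, integrability at 0. *)
Lemma weight_moment n L a l : (2 <= n)%N ->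
  0 < L <= (Num.sqrt 2 - 1) * gorder n ->
  a = - (L ^+ 2 * (L + 2 * gorder n) ^+ 2) -> L < l%:R ->
  (\int[leb]_(r in `]0%R, 1%R[) (weight (gorder n) L r * r ^+ l)%:E =
   (green_coef n a l)%:E)%E.
Proof.
move=> n2 hL aE Ll; have := gorder_gt0 n2; set lam := gorder n => lam0.
have nE : n%:R = 2 * lam + 1 :> R by rewrite /lam /gorder mulrC divfK// subrK.
have := discr_root_lt lam0 hL; have := discr_root_sqr lam0 hL.
set s := discr_root lam L => s2 /andP[s0 sm]; have L0 : 0 < L by case/andP: hL.
pose b := l%:R + lam; pose m := L + lam.
have mb : `|m| < b by rewrite ger0_norm /m /b ?ltrD2r// addr_ge0 ?ltW.
have sb : `|s| < b.
  by rewrite ger0_norm//; apply: lt_trans sm _; rewrite /b ltrD2r.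
pose kap := (2 * L * (L + 2 * lam))^-1.
pose F r := kap * (sinh_ln_primitive b s r - sinh_ln_primitive b m r).
have dF (x : R) : 0 < x < 1 -> is_derive x (1 : R) F (weight lam L x * x ^+ l).
  move=> /andP[x0 _]; have d1 := is_derive_sinh_ln_primitive sb x0.
  have d2 := is_derive_sinh_ln_primitive mb x0.
  apply: is_derive_eq; rewrite /GRing.scale /= /weight -/s -/m -/kap.
  have -> : b - 1 = (lam - 1) + l%:R by rewrite /b; ring.
  rewrite powRD_gt0// powR_mulrn ?ltW//; ring.
have F0 : F r @[r --> (0 : R)^'+] --> kap * (0 - 0).
  by apply: cvgMl_tmp; apply: cvgB; exact: sinh_ln_primitive_cvg0.
have F1 : F r @[r --> (1 : R)^'-] -->
    kap * (- (b ^+ 2 - s ^+ 2)^-1 - - (b ^+ 2 - m ^+ 2)^-1).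
  by apply: cvgMl_tmp; apply: cvgB; exact: sinh_ln_primitive_cvg1.
rewrite (ge0_improper_FTC2 _ _ _ dF F0 F1)//.
- congr (_%:E); rewrite subrr mulr0 subr0 /green_coef nE aE.
  have E1 : l%:R ^+ 2 * (2 * lam + 1 + l%:R - 1) ^+ 2 +
     - (L ^+ 2 * (L + 2 * lam) ^+ 2) = (b ^+ 2 - m ^+ 2) * (b ^+ 2 - s ^+ 2).
    by rewrite s2 /b /m; ring.
  have bm0 : b ^+ 2 - m ^+ 2 != 0.
    by rewrite subr_sqr gt_eqF// mulr_gt0// /b /m; lra.
  have bs0 : b ^+ 2 - s ^+ 2 != 0.
    by rewrite subr_sqr gt_eqF// mulr_gt0// /b; lra.
  have k0 : 2 * L * (L + 2 * lam) = m ^+ 2 - s ^+ 2 by rewrite s2 /m; ring.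
  have kN0 : m ^+ 2 - s ^+ 2 != 0.
    by rewrite -k0 !mulf_neq0// gt_eqF// addr_gt0// mulr_gt0.
  rewrite E1 /kap k0; field.
  by rewrite kN0 bm0 bs0.
- move=> x /andP[x0 x1]; rewrite mulr_ge0 ?exprn_ge0 ?(ltW x0)//.
  by rewrite weight_ge0// x0 ltW.
- move=> x /andP[x0 _]; apply: cvgM; first exact: continuous_weight.
  exact: exprn_continuous.
Qed.

End green_weight_moments.

(** * Series weighted by moments *)
Section moment_series.
Context {R : realType}.
Notation leb := (@lebesgue_measure R).
Implicit Types (r x y : R) (l N : nat).
Variables (W : R -> R) (m k : R^nat).
Let D : set R := `]0, 1[%classic.
Hypothesis W0 : forall r, 0 < r < 1 -> 0 <= W r.
Hypothesis Wc : forall r, 0 < r < 1 -> {for r, continuous W}.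
Hypothesis Wm : forall l, (\int[leb]_(r in D) (W r * r ^+ l)%:E = (m l)%:E)%E.
Hypothesis kP : poly_growth k.

Let DE r : D r -> 0 < r < 1. Proof. by rewrite /D /= in_itv. Qed.

Let mD : measurable D. Proof. exact: measurable_itv. Qed.

Let meas (f : R -> R) : (forall r, 0 < r < 1 -> {for r, continuous f}) ->
  measurable_fun D (fun r => (f r)%:E).
Proof.
move=> fc; apply/measurable_EFinP; apply: open_continuous_measurable_fun.
  exact: interval_open.
by move=> r /set_mem/DE/fc.
Qed.

Let contX l (r : R) : {for r, continuous (fun r : R => r ^+ l)}.
Proof. exact: exprn_continuous. Qed.

Let cont_part (c : R^nat) N r :
  {for r, continuous (fun r : R => W r)} ->
  {for r, continuous (fun r : R => W r * \sum_(0 <= l < N) c l * r ^+ l)}.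
Proof.
move=> cW.
suff h : {for r, continuous (fun r : R => \sum_(0 <= l < N) c l * r ^+ l)}.
  by apply: cvgM; [exact: cW|exact: h].
have ext (f g : R -> R) :
    f =1 g -> {for r, continuous g} -> {for r, continuous f}.
  by move=> /funext ->.
elim: N => [|N ih].
  by apply: (ext _ (cst 0)) => [x|]; [rewrite big_geq|exact: cvg_cst].
apply: (ext _ (fun x => \sum_(0 <= l < N) c l * x ^+ l + c N * x ^+ N)).
  by move=> x; rewrite big_nat_recr.
by apply: cvgD; [exact: ih|apply: cvgMl_tmp; exact: contX].
Qed.

Let contWX l r : 0 < r < 1 -> {for r, continuous (fun r : R => W r * r ^+ l)}.
Proof. by move=> r01; apply: cvgM; [exact: Wc|exact: contX]. Qed.

Lemma integrable_moment l : leb.-integrable D (fun r => (W r * r ^+ l)%:E).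
Proof.
apply/integrableP; split; first by apply: meas => r; exact: contWX.
under eq_integral => r /set_mem/DE r01.
  have /andP[r0 _] := r01.
  rewrite gee0_abs ?lee_fin ?mulr_ge0 ?exprn_ge0 ?(ltW r0) ?W0//; over.
by rewrite Wm ltry.
Qed.

Lemma integral_moment_sum (c : R^nat) N :
  (\int[leb]_(r in D) (W r * \sum_(0 <= l < N) c l * r ^+ l)%:E =
   (\sum_(0 <= l < N) m l * c l)%:E)%E.
Proof.
transitivity (\int[leb]_(r in D)
    (\sum_(0 <= l < N) (c l)%:E * (W r * r ^+ l)%:E))%E.
  apply: eq_integral => r _; rewrite mulr_sumr -sumEFin.
  by apply: eq_bigr => l _; rewrite -EFinM mulrCA.
rewrite integral_sum//; last first.
  by move=> l; apply: integrableZl => //; exact: integrable_moment.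
rewrite -sumEFin; apply: eq_bigr => l _.
by rewrite integralZl//; [rewrite Wm -EFinM mulrC|exact: integrable_moment].
Qed.

Let dom01 x r : 0 <= x -> x <= 1 -> 0 < r < 1 -> 0 <= r * x /\ `|r * x| < 1.
Proof.
move=> x0 x1 /andP[r0 r1]; have rx0 : 0 <= r * x by rewrite mulr_ge0// ltW.
by split => //; rewrite ger0_norm//; apply: le_lt_trans r1; rewrite ler_piMr// ltW.
Qed.

Let cont_psum x r : 0 <= x -> x <= 1 -> 0 < r < 1 ->
  {for r, continuous (fun r : R => W r * psum k (r * x))}.
Proof.
move=> x0 x1 r01; have [_ rx1] := dom01 x0 x1 r01.
have c : {for r, continuous (psum k \o (fun y : R => y * x))}.
  by apply: continuous_comp; [exact: mulrr_continuous|exact: continuous_psum].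
by apply: cvgM; [exact: Wc|exact: c].
Qed.

(** At x < 1 the partial sums of the series of the k l (r x)^l are bounded by
    the sum of the |k l| x^l uniformly in r, so the bound C times W dominates.
    *)
Lemma abel_mean_moments x : 0 <= x < 1 ->
  series (fun l => m l * k l * x ^+ l) @ \oo -->
    fine (\int[leb]_(r in D) (W r * psum k (r * x))%:E)%E /\
  leb.-integrable D (fun r => (W r * psum k (r * x))%:E).
Proof.
move=> /andP[x0 x1]; have x1' := ltW x1.
pose C := limn (series (fun l => `|k l| * `|x| ^+ l)).
have ax1 : `|x| < 1 by rewrite ger0_norm.
have Ccvg := is_cvg_pseries_norm kP ax1.
pose f_ N r := (W r * \sum_(0 <= l < N) (k l * x ^+ l) * r ^+ l)%:E.
have [] := @dominated_convergence _ _ _ leb D mD f_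
    (fun r => (W r * psum k (r * x))%:E) (fun r => C%:E * (W r * r ^+ 0)%:E)%E.
- move=> N; apply: meas => r r01; apply: cont_part; exact: Wc.
- by apply: meas => r; exact: cont_psum.
- apply: aeW => r /DE r01; apply: cvg_EFin; first exact: nearW.
  apply: cvgMl_tmp; have [_ rx1] := dom01 x0 x1' r01.
  have := cvg_psum kP rx1; apply: cvg_trans; apply: near_eq_cvg; near=> N.
  by apply: eq_bigr => l _; rewrite exprMn mulrA mulrAC.
- by apply: integrableZl => //; exact: integrable_moment.
- apply: aeW => r N /DE r01; have /andP[r0 r1] := r01.
  rewrite /f_ -EFinM lee_fin normrM (ger0_norm (W0 r01)) expr0 mulr1 mulrC.
  rewrite ler_wpM2r ?W0//.
  apply: (@le_trans _ _ (series (fun l => `|k l| * `|x| ^+ l) N)).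
    apply: le_trans (ler_norm_sum _ _ _) _; apply: ler_sum => l _.
    rewrite !normrM normrX -[leRHS]mulr1 ler_wpM2l ?mulr_ge0 ?exprn_ge0//.
    by rewrite ger0_norm ?exprn_ge0 ?exprn_ile1 ?(ltW r0) ?(ltW r1).
  apply: nondecreasing_cvgn_le => //.
  by apply: nondecreasing_series => l _ _; rewrite mulr_ge0 ?exprn_ge0.
move=> iWK _ cWK; split => //.
have fin : (\int[leb]_(r in D) (W r * psum k (r * x))%:E)%E \is a fin_num.
  exact: integrable_fin_num.
move: cWK; rewrite -(fineK fin) => /fine_cvg; apply: cvg_trans.
apply: near_eq_cvg; near=> N.
rewrite /= /f_ integral_moment_sum /=.
by apply: eq_bigr => l _; rewrite mulrA.
Unshelve. all: by end_near. Qed.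

Lemma abel_cvg_moments : abel_cvg (fun l => m l * k l).
Proof. by move=> x /abel_mean_moments[+ _] => /cvgP. Qed.

(** A bound on the sum of the power series, rather than on its partial sums,
    is enough here: the interchange of sum and integral has already been done
    at each x < 1, and only x varies. *)
Lemma abel_mean_moments_bounded C :
  (forall y, 0 <= y < 1 -> `|psum k y| <= C) ->
  leb.-integrable D (fun r => (W r * psum k r)%:E) /\
  (abel_mean (fun l => m l * k l) x)%:E @[x --> (1 : R)^'-] -->
    (\int[leb]_(r in D) (W r * psum k r)%:E)%E.
Proof.
move=> kC; have C0 : 0 <= C.
  by have := kC 0; rewrite lexx ltr01 => /(_ isT); apply: le_trans.
have iC : leb.-integrable D (fun r => (C%:E * (W r * r ^+ 0)%:E)%E).
  by apply: integrableZl => //; exact: integrable_moment.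
have bnd x r : 0 <= x -> x <= 1 -> 0 < r < 1 ->
    (`|(W r * psum k (r * x))%:E| <= C%:E * (W r * r ^+ 0)%:E)%E.
  move=> x0 x1 r01; have [rx0 rx1] := dom01 x0 x1 r01.
  rewrite -EFinM lee_fin normrM (ger0_norm (W0 r01)) expr0 mulr1 mulrC.
  by rewrite ler_wpM2r ?W0// kC// rx0 -(ger0_norm rx0).
have cW1 (r : R) : 0 < r < 1 -> {for r, continuous (fun r : R => W r * psum k r)}.
  move=> r01; apply: cvgM; first exact: Wc.
  apply: continuous_psum => //; have /andP[r0 r1] := r01.
  by rewrite ger0_norm// ltW.
have iWK : leb.-integrable D (fun r => (W r * psum k r)%:E).
  apply: le_integrable iC => //; first by apply: meas.
  move=> r /DE r01; have := @bnd 1 r ler01 (lexx 1) r01; rewrite mulr1 => h.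
  by apply: le_trans h _; exact: lee_abs.
split => //.
have fin : (\int[leb]_(r in D) (W r * psum k r)%:E)%E \is a fin_num.
  exact: integrable_fin_num.
rewrite -(fineK fin); apply/cvge_at_leftP => u [u1 ucvg].
rewrite (fineK fin).
(* A sequence tending to 1 from the left may start below 0, outside the range
   of the bound; clipping it changes finitely many terms. *)
pose v n := Num.max (u n) 0.
have v0 n : 0 <= v n by rewrite le_max lexx orbT.
have v1 n : v n < 1 by rewrite gt_max u1 ltr01.
have vu : \forall n \near \oo, v n = u n.
  have : \forall n \near \oo, 0 <= u n by apply: (cvgr_ge _ ucvg).
  by apply: filterS => n un0; rewrite /v max_l.
have vcvg : v @ \oo --> (1 : R).
  by apply: cvg_trans ucvg; apply: near_eq_cvg; near do apply/esym.
have [] := @dominated_convergence _ _ _ leb D mD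
    (fun n r => (W r * psum k (r * v n))%:E) (fun r => (W r * psum k r)%:E)
    (fun r => C%:E * (W r * r ^+ 0)%:E)%E.
- by move=> n; apply: meas => r; apply: cont_psum => //; exact: ltW.
- exact: meas.
- apply: aeW => r /DE r01; apply: cvg_EFin; first exact: nearW.
  apply: cvgMl_tmp; have /andP[r0 r1] := r01.
  have rn : `|r| < 1 by rewrite ger0_norm// ltW.
  have rv : (fun n => (r : R) * v n) @ \oo --> (r : R).
    by rewrite -[X in _ --> X]mulr1; apply: cvgMl_tmp.
  exact: (cvg_comp _ _ rv (continuous_psum kP rn)).
- exact: iC.
- by apply: aeW => r n /DE r01; apply: bnd => //; exact: ltW.
move=> _ _; apply: cvg_trans; apply: near_eq_cvg.
near=> n; have vn01 : 0 <= v n < 1 by rewrite v0 v1.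
have [mean vint] := abel_mean_moments vn01.
have <- : v n = u n by near: n.
rewrite /abel_mean (cvg_lim (@Rhausdorff R) mean).
by rewrite fineK//; exact: integrable_fin_num.
Unshelve. all: by end_near. Qed.

Lemma has_sum_moments : (forall l, 0 <= k l) ->
  has_sum (fun l => m l * k l) (\int[leb]_(r in D) (W r * psum k r)%:E)%E.
Proof.
move=> k0; rewrite /has_sum.
pose f_ N r := (W r * \sum_(0 <= l < N) k l * r ^+ l)%:E.
have := @cvg_monotone_convergence _ _ _ leb D mD f_.
have <- : (\int[leb]_(r in D) limn (f_ ^~ r) =
    \int[leb]_(r in D) (W r * psum k r)%:E)%E.
  apply: eq_integral => r /set_mem/DE r01; apply/cvg_lim => //.
  apply: cvg_EFin; first exact: nearW.
  apply: cvgMl_tmp; apply: cvg_psum => //; have /andP[r0 r1] := r01.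
  by rewrite ger0_norm// ltW.
move=> H; have {}H := H _ _ _.
under eq_fun do rewrite -integral_moment_sum.
apply: H.
- move=> N; apply: meas => r r01; apply: cont_part; exact: Wc.
- move=> N r /DE r01; rewrite lee_fin mulr_ge0 ?W0//; apply: sumr_ge0 => l _.
  by have /andP[r0 _] := r01; rewrite mulr_ge0// exprn_ge0// ltW.
- move=> r /DE r01 N N' NN'; have /andP[r0 _] := r01.
  rewrite lee_fin ler_wpM2l ?W0//.
  have := @nondecreasing_series _ (fun l => k l * r ^+ l) xpredT 0.
  by move=> -> // l _ _; rewrite mulr_ge0// exprn_ge0// ltW.
Qed.

End moment_series.

(** * The area of the sphere does not vanish *)
Section gamma_positive.
Context {R : realType}.
Implicit Types (p u x : R).
Notation leb := (@lebesgue_measure R).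

(** One term of the exponential series at u / 2, of degree above p, beats
    u^p for u >= 1; the summand 1 in the constant covers u <= 1. *)
Lemma powR_expR_le p : 0 <= p ->
  exists C, forall u, 0 <= u -> u `^ p * expR (- u) <= C * expR (- (u / 2)).
Proof.
move=> p0; pose K := Num.truncn p; pose C := 1 + 2 ^+ K.+1 * K.+1`!%:R : R.
exists C => u u0.
have -> : expR (- u) = expR (- (u / 2)) * expR (- (u / 2)).
  by rewrite -expRD -opprD -splitr.
rewrite mulrA ler_wpM2r ?expR_ge0// expRN ler_pdivrMr ?expR_gt0//.
have e1 : 1 <= expR (u / 2) by rewrite -expR0 ler_expR divr_ge0.
have h : u ^+ K.+1 <= 2 ^+ K.+1 * K.+1`!%:R * expR (u / 2).
  rewrite -mulrA -ler_pdivrMl ?exprn_gt0// -ler_pdivrMl ?ltr0n ?fact_gt0//.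
  rewrite mulrC -exprVn -exprMn [2^-1 * u]mulrC.
  have := @expR_ge1Dxn _ (u / 2) K; rewrite divr_ge0// => /(_ isT).
  by apply: le_trans; rewrite lerDr.
have [u1|u1] := leP u 1.
  apply: (@le_trans _ _ 1).
    have e : (1 : R) `^ p = 1 by rewrite powR1.
    by rewrite -e ge0_ler_powR// nnegrE.
  rewrite (le_trans e1)// ler_peMl ?expR_ge0//.
  by rewrite lerDl mulr_ge0 ?exprn_ge0.
apply: (@le_trans _ _ (u ^+ K.+1)).
  rewrite -powR_mulrn// ler_powR ?(ltW u1)//; apply/ltW; exact: truncnS_gt.
by rewrite (le_trans h)// mulrDl lerDr mul1r expR_ge0.
Qed.

(** The value of the integral as a real number is positive only once the
    integral is known to be finite; [powR_expR_le] compares it with an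
    exponential distribution.  Restricting to [1, 2] bounds it from below. *)
Lemma Gamma_gt0 x : 1 <= x -> 0 < Gamma x.
Proof.
move=> x1; have p0 : 0 <= x - 1 by rewrite subr_ge0.
pose f u := u `^ (x - 1) * expR (- u).
pose D : set R := `]0, +oo[%classic.
have f0 u : 0 <= f u by rewrite mulr_ge0 ?powR_ge0 ?expR_ge0.
have mf : measurable_fun setT f.
  by apply: measurable_funM; [exact: measurable_powR|exact: measurableT_comp].
have mfD : measurable_fun D (EFin \o f).
  by apply/measurable_EFinP; exact: measurable_funTS.
have [C fC] := powR_expR_le p0.
have iexp : leb.-integrable D (EFin \o exponential_pdf 2^-1).
  apply: (@integrableS _ _ _ _ setT) => //; first exact: measurable_itv.
  by apply: integrable_exponential_pdf; rewrite invr_gt0.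
have ifD : leb.-integrable D (EFin \o f).
  have iC : leb.-integrable D
      (fun u => (C * 2)%:E * (EFin \o exponential_pdf 2^-1) u)%E.
    by apply: integrableZl => //; exact: measurable_itv.
  apply: le_integrable iC => //; first exact: measurable_itv.
  move=> u.
  rewrite /D /= in_itv/= andbT => u0.
  have -> : exponential_pdf 2^-1 u = 2^-1 * expR (- 2^-1 * u).
    by rewrite exponential_pdfE// ltW.
  rewrite lee_fin ger0_norm//.
  apply: (le_trans _ (ler_norm _)).
  have -> : C * 2 * (2^-1 * expR (- 2^-1 * u)) = C * expR (- (u / 2)).
    by rewrite mulNr [_ * u]mulrC mulrA mulfK// pnatr_eq0.
  exact/fC/ltW.
have fin : (\int[leb]_(u in D) (f u)%:E)%E \is a fin_num.
  by apply: integrable_fin_num => //; exact: measurable_itv.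
rewrite /Gamma /Rintegral fine_gt0//; apply/andP; split; last first.
  by move: fin; rewrite fin_numElt => /andP[].
apply: (@lt_le_trans _ _ (\int[leb]_(u in `[1%R, 2%R]) (expR (- 2))%:E)%E).
  rewrite integral_cst//= lebesgue_measure_itv/= lte_fin ltr1n/=.
  by rewrite -EFinD -EFinM lte_fin mulr_gt0 ?expR_gt0// subr_gt0 ltr1n.
apply: (@le_trans _ _ (\int[leb]_(u in `[1%R, 2%R]) (f u)%:E)%E).
  apply: ge0_le_integral => //.
  - by apply/measurable_EFinP; exact: measurable_funTS.
  - move=> u; rewrite /= in_itv/= => /andP[u1 u2].
    rewrite lee_fin /f -[leLHS]mul1r ler_pM ?expR_ge0//.
      by rewrite -[leLHS](powRr0 u) ler_powR.
    by rewrite ler_expR lerN2.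
rewrite -/D; apply: (@ge0_subset_integral _ _ _ leb _ D _ _ (EFin \o f)) => //.
- exact: measurable_itv.
- by move=> u _; rewrite lee_fin.
- by move=> u; rewrite /D /= !in_itv/= andbT => /andP[u1 _]; exact: lt_le_trans u1.
Qed.

Lemma sphere_area_neq0 n : (0 < n)%N -> sphere_area n != 0 :> R.
Proof.
move=> n0; rewrite gt_eqF// /sphere_area divr_gt0 ?mulr_gt0 ?powR_gt0 ?pi_gt0//.
by apply: Gamma_gt0; rewrite ler_pdivlMr// mul1r ler_nat.
Qed.

End gamma_positive.

(** * The Green function *)
Section green_function.
Context {R : realType}.
Implicit Types (a L t th r y : R) (n l : nat).
Notation leb := (@lebesgue_measure R).

(** The quadratic is (1 - r)^2 + 2 r (1 - t): the first summand is at least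
    1/4 for r <= 1/2, the second at least 1 - t for r >= 1/2. *)
Lemma gen_quad_ge t r : t <= 1 -> 0 <= r -> r <= 1 ->
  Num.min 4^-1 (1 - t) <= 1 - 2 * t * r + r ^+ 2.
Proof.
move=> t1 r0 r1; rewrite ge_min.
have -> : 1 - 2 * t * r + r ^+ 2 = (1 - r) ^+ 2 + 2 * r * (1 - t) by ring.
have [rh|rh] := leP r 2^-1; apply/orP; [left|right].
  rewrite -[leLHS]addr0 lerD ?mulr_ge0 ?subr_ge0//.
  have -> : 4^-1 = 2^-1 ^+ 2 :> R by rewrite exprVn -natrX.
  by rewrite lerXn2r ?nnegrE ?subr_ge0 ?invr_ge0//; lra.
rewrite -[leLHS]add0r lerD ?exprn_ge0 ?subr_ge0// ler_peMl ?subr_ge0//; lra.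
Qed.

Lemma psum_zonal_bounded lam th : 0 < lam -> cos th < 1 -> exists B, forall y,
  0 <= y < 1 -> `|psum (fun l => zonal_harmonic lam l (cos th)) y| <= B.
Proof.
move=> lam0 t1; set t := cos th; pose c := Num.min 4^-1 (1 - t).
have c0 : 0 < c by rewrite lt_min invr_gt0 ltr0n subr_gt0.
exists (c `^ (lam + 1))^-1 => y /andP[y0 y1].
have y1' : `|y| < 1 by rewrite ger0_norm.
rewrite psum_zonal// -/t.
have cq : c <= 1 - 2 * t * y + y ^+ 2 by apply: gen_quad_ge => //; exact: ltW.
have q0 := lt_le_trans c0 cq.
rewrite normrM -[leRHS]mul1r ler_pM//.
  by rewrite ger0_norm ?subr_ge0 ?exprn_ile1 ?(ltW y1)// lerBlDr lerDl exprn_ge0.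
rewrite ger0_norm ?invr_ge0 ?powR_ge0// lef_pV2 ?posrE ?powR_gt0//.
by apply: ge0_ler_powR; rewrite ?nnegrE ?(ltW c0) ?(ltW q0)// addr_ge0// ltW.
Qed.

Lemma green_integrandE n L th r : (2 <= n)%N -> 0 < L -> 0 < r < 1 ->
  green_integrand n L (cos th) r =
  weight (gorder n) L r * r ^+ (Num.truncn L).+1 *
  psum (fun l => zonal_harmonic (gorder n) (l + (Num.truncn L).+1)%N (cos th)) r.
Proof.
move=> n2 L0 /andP[r0 r1]; have lam0 : 0 < gorder n :> R := gorder_gt0 n2.
have r1' : `|r| < 1 by rewrite ger0_norm// ltW.
rewrite /green_integrand green_weightE// -mulrA; congr (_ * _).
rewrite /poisson_kernel mulrA divff ?sphere_area_neq0 ?mul1r//; last exact: ltnW.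
pose h l := zonal_harmonic (gorder n) l (cos th).
have hP : poly_growth h by exact: poly_growth_zonal.
rewrite (_ : (fun l => _) = (fun l => h l * r ^+ l)); last first.
  by apply/funext => l; rewrite mulrC.
rewrite -[limn _]/(psum h r) (psum_shift (Num.truncn L).+1 hP r1').
under eq_bigr do rewrite mulrC.
by rewrite addrAC subrr add0r.
Qed.

(** The two ranges differ only when L is an integer, and then by the index
    l = L, whose term is 0 by definition. *)
Lemma sum_green_term n a L t : 0 < L ->
  \sum_(0 <= l < (Num.truncn L).+1) green_term n a L t l =
  \sum_(0 <= l < `|Num.ceil L|%N) green_coef n a l * zonal_harmonic (gorder n) l t.
Proof.
move=> L0; set C := `|Num.ceil L|%N; set N := (Num.truncn L).+1.
have C0 : 0 <= Num.ceil L by rewrite ltW// ceil_gt0.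
have ltC l : (l < C)%N = (l%:R < L).
  by rewrite -(ceil_gt_int L l) /C -ltz_nat gez0_abs.
have CN : (C <= N)%N.
  by rewrite leqNgt ltC -leNgt ltW// truncnS_gt.
rewrite (big_cat_nat (leq0n C) CN) /= [X in _ + X]big1_seq ?addr0.
  apply: eq_big_nat => l /andP[_]; rewrite ltC => lL.
  by rewrite /green_term lt_eqF.
move=> l /=; rewrite mem_index_iota => /andP[]; rewrite leqNgt ltC -leNgt => Ll.
rewrite ltnS => lN; rewrite /green_term; suff -> : l%:R == L by [].
rewrite eq_le Ll andbT (le_trans (_ : _ <= (Num.truncn L)%:R))// ?ler_nat//.
by rewrite truncn_le ltW.
Qed.

End green_function.

Theorem theorem4p1 (R : realType) (n : nat) (a L theta : R) :
  (2 <= n)%N ->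
  0 < L <= (Num.sqrt 2 - 1) * gorder n ->
  a = - (L ^+ 2 * (L + 2 * gorder n) ^+ 2) ->
  0 <= theta <= pi ->
  [/\ 0 < theta ->
        (@lebesgue_measure R).-integrable `]0, 1[
          (EFin \o green_integrand n L (cos theta)),
      has_abel_sum (green_term n a L (cos theta))
        (green_closed_form n a L (cos theta))
    & forall S : \bar R, has_sum (green_term n a L (cos theta)) S ->
        S = green_closed_form n a L (cos theta)].
Proof.
move=> n2 hL aE /andP[th0 thpi].
have lam0 : 0 < gorder n :> R := gorder_gt0 n2.
have L0 : 0 < L by case/andP: hL.
set N := (Num.truncn L).+1; set t := cos theta; set u := green_term n a L t.
have LN l : L < (l + N)%:R.
  by apply: (lt_le_trans (truncnS_gt L)); rewrite ler_nat leq_addl.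
pose W r := weight (gorder n) L r * r ^+ N.
pose m l := green_coef n a (l + N).
pose k l := zonal_harmonic (gorder n) (l + N) t.
have hP : poly_growth (fun l => zonal_harmonic (gorder n) l t).
  exact: poly_growth_zonal.
have kP : poly_growth k by exact: (poly_growth_shift N hP).
have uE : (fun l => u (l + N)%N) = (fun l => m l * k l).
  by apply/funext => l; rewrite /u /green_term gt_eqF.
have W0 (r : R) : 0 < r < 1 -> 0 <= W r.
  move=> /andP[r0 r1]; rewrite mulr_ge0 ?exprn_ge0 ?(ltW r0)//.
  by rewrite weight_ge0// r0 ltW.
have Wc (r : R) : 0 < r < 1 -> {for r, continuous W}.
  move=> /andP[r0 _]; apply: cvgM; first exact: continuous_weight.
  exact: exprn_continuous.
have Wm l : (\int[@lebesgue_measure R]_(r in `]0%R, 1%R[) (W r * r ^+ l)%:E =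
    (m l)%:E)%E.
  rewrite -(weight_moment n2 hL aE (LN l)); apply: eq_integral => r _.
  by rewrite /W -mulrA -exprD addnC.
have ucvg : abel_cvg u.
  by apply: (@abel_cvg_shift _ _ N); rewrite uE; exact: abel_cvg_moments W0 Wc Wm kP.
pose I := (\int[@lebesgue_measure R]_(r in `]0%R, 1%R[) (W r * psum k r)%:E)%E.
have closedE : green_closed_form n a L t =
    (I + (\sum_(0 <= l < N) u l)%:E)%E.
  rewrite /green_closed_form -sum_green_term//; congr (_ + _)%E.
  apply: eq_integral => r; rewrite inE /= in_itv/= => r01.
  by rewrite green_integrandE.
have regular : 0 < theta ->
    (@lebesgue_measure R).-integrable `]0, 1[ (fun r => (W r * psum k r)%:E) /\
    (abel_mean (fun l => m l * k l) x)%:E @[x --> (1 : R)^'-] --> I.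
  move=> th_gt0; have t1 : t < 1.
    rewrite lt_neqAle cos_le1 andbT; apply/eqP => t1.
    have : theta = 0 by apply: cos_inj; rewrite ?in_itv/= ?th0 ?lexx ?pi_ge0// cos0.
    by move/eqP; rewrite gt_eqF.
  have [B hB] := psum_zonal_bounded lam0 t1.
  have [C kC] := psum_shift_bounded N hP hB.
  exact: (abel_mean_moments_bounded W0 Wc Wm kP kC).
have abelS : has_abel_sum u (green_closed_form n a L t).
  rewrite closedE.
  have [th_gt0|] := ltP 0 theta.
    have [iWK abI] := regular th_gt0.
    have fin : I \is a fin_num by exact: integrable_fin_num.
    rewrite -(fineK fin) -EFinD; apply: has_abel_sum_shift; rewrite uE.
      exact: abel_cvg_moments W0 Wc Wm kP.
    by rewrite fineK.
  move=> th_le0; have t1 : t = 1.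
    by rewrite /t (_ : theta = 0) ?cos0//; apply/eqP; rewrite eq_le th_le0.
  split => //; apply: abel_theorem => //; apply: has_sum_shift; rewrite uE.
  apply: has_sum_moments W0 Wc Wm kP _ => l.
  by rewrite /k t1 zonal_harmonic_ge0.
split => //.
- move=> /regular[iWK _]; apply: eq_integrable iWK => // r.
  by rewrite inE /= in_itv/= => r01; rewrite green_integrandE.
- move=> S /(abel_theorem ucvg) uS.
  exact: (cvg_unique (@ereal_hausdorff R) uS abelS.2).
Qed.
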